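(* For every integer $b\geq 2$ the set $\mathbb{R}\setminus BE_b$ is immeasurable, where $BE_b$ is the set of real numbers for which the asymptotic frequency of every base-$b$ digit exists (see context).
   Context: Let $b\ge 2$ be an integer. For $x\in\mathbb{R}$ let $\{x\}=0.d_1d_2\ldots$ be the base-$b$ expansion of the fractional part $\{x\}=x-\lfloor x\rfloor$; if there are two such expansions, choose the one with finitely many nonzero digits. For reals $\alpha_0,\ldots,\alpha_{b-1}\geq 0$ with $\sum_{d=0}^{b-1}\alpha_d=1$, let $BE(\alpha_0,\ldots,\alpha_{b-1})$ be the set of $x\in\mathbb{R}$ such that $\lim_{n\to\infty}\frac{1}{n}\mathrm{card}(\{i:1\leq i\leq n,\ d_i=d\})=\alpha_d$ for every $d=0,\ldots,b-1$. The set $BE_b$ is the union of all the classes $BE(\alpha_0,\ldots,\alpha_{b-1})$ (with $b$ fixed). A Borel measure on $\mathbb{R}$ is a (countably additive, $[0,\infty]$-valued) measure $\mu$ defined on a $\sigma$-algebra $\mathcal{S}$ of subsets of $\mathbb{R}$ containing all Borel sets ($\mathcal S$ may be larger than the Borel $\sigma$-algebra, and $\mu$ is not assumed to be $\sigma$-finite on $\mathbb{R}$). It is translation invariant if $S+t\in\mathcal{S}$ and $\mu(S+t)=\mu(S)$ for all $S\in\mathcal{S}$, $t\in\mathbb{R}$. A Borel set $B$ is $\sigma$-finite for $\mu$ if it is a countable union of sets in $\mathcal{S}$ of finite $\mu$-measure. A nonempty Borel set $B\subset\mathbb{R}$ is called immeasurable if for every translation invariant Borel measure $\mu$ on $\mathbb{R}$,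 either $\mu(B)=0$ or $B$ is not $\sigma$-finite for $\mu$. *)

(* Defs.v *)
From HB Require Import structures.
From mathcomp Require Import all_boot all_order all_algebra.
From mathcomp Require Import all_classical all_reals all_analysis.

Set Implicit Arguments.
Unset Strict Implicit.
Unset Printing Implicit Defensive.

Import Order.TTheory GRing.Theory Num.Theory.
Import numFieldNormedType.Exports.

Local Open Scope classical_set_scope.
Local Open Scope ring_scope.

Definition frac_part (R : realType) (x : R) : R := x - (Num.floor x)%:~R.

(* Digits are indexed from 0: the value d i stands for the (i+1)-st digit
   after the point, y = 0.(d 0)(d 1)(d 2)... in base b. *)
Definition base_expansion (R : realType) (b : nat) (y : R) (d : nat -> 'I_b) :
    Prop :=
  [series (d i)%:R / b%:R ^+ i.+1 : R]_i @ \oo --> y.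

Definition finitely_many_nonzero_digits (b : nat) (d : nat -> 'I_b) : Prop :=
  finite_set [set i | (d i != 0 :> nat)%N].

(* If the fractional part of x has another expansion than d, then d is the one
   with finitely many nonzero digits. *)
Definition digit_sequence (R : realType) (b : nat) (x : R) (d : nat -> 'I_b) :
    Prop :=
  base_expansion (frac_part x) d /\
  ((exists2 e : nat -> 'I_b, base_expansion (frac_part x) e & e <> d) ->
   finitely_many_nonzero_digits d).

(* The quotient at n = 0 is 0 and does not affect the limit. *)
Definition has_digit_frequency (R : realType) (b : nat) (d : nat -> 'I_b)
    (k : 'I_b) (a : R) : Prop :=
  (#|[pred i : 'I_n | d i == k]|%:R / n%:R : R) @[n --> \oo] --> a.

Definition BE_class (R : realType) (b : nat) (alpha : 'I_b -> R) : set R :=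
  [set x | exists2 d : nat -> 'I_b, digit_sequence x d &
                   forall k, has_digit_frequency d k (alpha k)].

Definition BE (R : realType) (b : nat) : set R :=
  \bigcup_(alpha in [set alpha : 'I_b -> R |
      (forall k, 0 <= alpha k) /\ \sum_(k < b) alpha k = 1]) BE_class alpha.

Definition translate (R : realType) (A : set R) (t : R) : set R :=
  [set x + t | x in A].

(* When S is a sigma-algebra, the measurable sets of g_sigma_algebraType S are
   exactly the members of S (measurable_g_measurableTypeE). *)
Definition translation_invariant (R : realType) (S : set (set R))
    (mu : {measure set (g_sigma_algebraType S) -> \bar R}) : Prop :=
  forall (A : set R) (t : R), S A ->
    S (translate A t) /\ mu (translate A t) = mu A.

(* On R, measurable is the Borel sigma-algebra. *)
Definition immeasurable (R : realType) (B : set R) : Prop :=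
  [/\ B !=set0,
      measurable B &
      forall (S : set (set R)),
        sigma_algebra setT S -> measurable `<=` S ->
        forall mu : {measure set (g_sigma_algebraType S) -> \bar R},
          translation_invariant mu ->
          mu B = 0%E \/ ~ sigma_finite (B : set (g_sigma_algebraType S)) mu].

(* Main.v *)
Require Import Defs.
From mathcomp Require Import all_boot all_order all_algebra.
From mathcomp Require Import all_classical all_reals all_analysis.
From mathcomp Require Import measurable_realfun.
From mathcomp Require Import zify ring lra.

(* Let B be the complement of BE_b, with mu sigma-finite on B, and call a set
   null when it has mu-measure 0. Fix u. A shift t whose base-b digits vanish
   outside the blocks [u 2^m, (u + 1) 2^m) moves a point x of B back into B,
   provided that u is large compared with the oscillation of the digit
   frequencies of x: only a proportion O(1/u) of the digits changes. The only
   obstruction is a carry crossing long runs, which forces x + t to have almost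
   all digits 0; this cannot happen for both t and t + s if s has alternating
   digits 1, 0, 1, 0, ... on the blocks [(u + 1) 2^m, (u + 2) 2^m).

   A point x of B has, for some such u, infinitely many m for which the digits
   of x in [u 2^m, (u + 1) 2^m) are far from equidistributed. Let V be the set
   of these x. By Chebyshev's inequality, nearly all digit strings of length 2^m
   are equidistributed, so by averaging over the strings that t may carry in
   each block and by the Borel-Cantelli lemma, some t is such that y - t is
   outside V for almost every y in B. Hence (V + t) n B is null. By translation
   invariance so is the set of the x in V such that x + t is in B, and the same
   holds for t + s. These sets, for countably many choices of parameters, cover B. *)

Set Implicit Arguments.
Unset Strict Implicit.
Unset Printing Implicit Defensive.
Import Order.TTheory GRing.Theory Num.Theory.
Import numFieldNormedType.Exports.
Local Open Scope classical_set_scope.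
Local Open Scope ring_scope.

(** * Digits and carries *)

Section Digits.
Variables (R : realType) (b : nat).
Hypothesis hb : (1 < b)%N.
Implicit Types (x y : R) (i n k : nat).

(* Floors select the expansion with finitely many nonzero digits whenever there
   are two. *)
Definition scaled_floor i x : int := Num.floor (b%:R ^+ i * x).

Definition digit x i : int := scaled_floor i.+1 x - b%:Z * scaled_floor i x.

(* The carry from position [i] to its left when [x] and [y] are added. *)
Definition carry x y i : int :=
  scaled_floor i (x + y) - scaled_floor i x - scaled_floor i y.

Lemma scaled_floor_itv i x :
  (scaled_floor i x)%:~R <= b%:R ^+ i * x < (scaled_floor i x)%:~R + 1.
Proof. by have := floor_itv (b%:R ^+ i * x); rewrite intrD. Qed.

Lemma scaled_floorP i x (z : int) :
  z%:~R <= b%:R ^+ i * x < z%:~R + 1 -> scaled_floor i x = z.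
Proof. by move=> h; apply: floor_def; rewrite intrD. Qed.

Lemma digit_itv x i : 0 <= digit x i < b%:Z.
Proof.
have /andP[l1 u1] := scaled_floor_itv i x.
have /andP[l2 u2] := scaled_floor_itv i.+1 x.
have b0 : 0 < b%:R :> R by rewrite ltr0n; lia.
rewrite exprS -mulrA in l2 u2.
rewrite -ltzD1 /digit -(@ltr_int R) -[X in _ && X](@ltr_int R).
rewrite !rmorphD !rmorphN /= !intrM -!pmulrn;
  set B : R := b%:R in b0 l1 u1 l2 u2 *.
have := ler_wpM2l (ltW b0) l1.
have : B * (B ^+ i * x) < B * ((scaled_floor i x)%:~R + 1) by rewrite ltr_pM2l.
rewrite mulrDr mulr1 => h1 h2; apply/andP; split; lra.
Qed.

Lemma carry_itv x y i : 0 <= carry x y i <= 1.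
Proof.
have /andP[l1 u1] := scaled_floor_itv i x.
have /andP[l2 u2] := scaled_floor_itv i y.
have /andP[l3 u3] := scaled_floor_itv i (x + y).
rewrite mulrDr in l3 u3.
have lo : 0 < carry x y i + 1.
  rewrite /carry -(@ltr_int R) !rmorphD !rmorphN /=; lra.
have hi : carry x y i < 2.
  rewrite /carry -(@ltr_int R) !rmorphD !rmorphN /=; lra.
lia.
Qed.

Lemma digitD x y i :
  digit (x + y) i = digit x i + digit y i + carry x y i.+1 - b%:Z * carry x y i.
Proof. by rewrite /digit /carry; ring. Qed.

(** Division by the positive integer [b] rounds down, so it drops the last digit of
    [scaled_floor n x], for negative [x] too. Conditions on the first [n] digits thus become
    conditions on one integer. *)
Lemma digit_scaled_floor x n k : (k < n)%N ->
  digit x (n - k.+1) = modz (divz (scaled_floor n x) (b%:Z ^+ k)) b%:Z.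
Proof.
move=> kn.
have {kn}[i ->] : exists i, n = (i + k.+1)%N by exists (n - k.+1)%N; lia.
rewrite addnK.
have sf_div j : divz (scaled_floor j.+1 x) b%:Z = scaled_floor j x.
  have -> : scaled_floor j.+1 x = scaled_floor j x * b%:Z + digit x j.
    by rewrite /digit; ring.
  rewrite divzMDl; last by lia.
  by rewrite divz_small ?addr0 //; have := digit_itv x j; lia.
have -> : divz (scaled_floor (i + k.+1) x) (b%:Z ^+ k) = scaled_floor i.+1 x.
  elim: k => [|k IH]; first by rewrite expr0 divz1 addn1.
  by rewrite exprS divzMA_ge0 ?addnS ?sf_div -?addnS //.
have -> : scaled_floor i.+1 x = scaled_floor i x * b%:Z + digit x i by rewrite
  /digit; ring.
rewrite modzMDl modz_small //; have := digit_itv x i; lia.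
Qed.
End Digits.

(** * Convergent base-b expansions and the digits given by floors *)

Section Expansions.
Variables (R : realType) (b : nat).
Hypothesis hb : (1 < b)%N.
Implicit Types (x y : R) (i n k : nat) (d : nat -> nat).

Definition expansion d : R^nat := [series (d i)%:R / b%:R ^+ i.+1]_i.

Let b_gt0 : 0 < b%:R :> R. Proof. by rewrite ltr0n ltnW. Qed.
Let bX_gt0 n : 0 < b%:R ^- n :> R. Proof. by rewrite invr_gt0 exprn_gt0. Qed.

Lemma expansionS d n :
  expansion d n.+1 = expansion d n + (d n)%:R * b%:R ^- n.+1.
Proof. by rewrite /expansion /series /= big_nat_recr. Qed.

Lemma expn_invS n : b%:R ^- n = b%:R * b%:R ^- n.+1 :> R.
Proof. by rewrite exprS invfM mulrA divff ?mul1r // gt_eqF. Qed.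

Lemma expansion_nondecreasing d : nondecreasing_seq (expansion d).
Proof.
apply/nondecreasing_seqP => n; rewrite expansionS lerDl.
by rewrite mulr_ge0 // ltW.
Qed.

Lemma expansion_tail_nonincreasing d : (forall i, (d i < b)%N) ->
  nonincreasing_seq (fun n => expansion d n + b%:R ^- n).
Proof.
move=> db; apply/nonincreasing_seqP => n; rewrite expansionS (expn_invS n).
rewrite -addrA lerD2l -[X in _ + X]mul1r -mulrDl ler_pM2r //.
by rewrite natr1 ler_nat db.
Qed.

Lemma is_cvg_expansion d : (forall i, (d i < b)%N) ->
  cvgn (expansion d).
Proof.
move=> db; apply: nondecreasing_is_cvgn; first exact: expansion_nondecreasing.
exists 1 => _ [n _ <-].
have := expansion_tail_nonincreasing db (leq0n n).
rewrite expr0 invr1 {2}/expansion /series /= big_geq // add0r.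
by apply: le_trans; rewrite lerDl ltW.
Qed.

Lemma cvg_expn_inv : (b%:R ^- n : R) @[n --> \oo] --> 0.
Proof.
under eq_fun do rewrite -exprVn.
by apply: cvg_expr; rewrite ger0_norm ?invr_ge0 ?(ltW b_gt0) // invf_lt1 //
  ltr1n.
Qed.

Lemma expansion_bounds d y : (forall i, (d i < b)%N) ->
  expansion d @ \oo --> y -> forall n,
  expansion d n <= y <= expansion d n + b%:R ^- n.
Proof.
move=> db cy n.
have <- : limn (expansion d) = y by exact/cvg_lim.
apply/andP; split.
  apply: nondecreasing_cvgn_le; first exact: expansion_nondecreasing.
  exact: is_cvg_expansion.
have cU : (fun n => expansion d n + b%:R ^- n) @ \oo --> y.
  by rewrite -[y]addr0; apply: cvgD => //; exact: cvg_expn_inv.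
have -> : limn (expansion d) = limn (fun n => expansion d n + b%:R ^- n).
  by rewrite (cvg_lim _ cy) // (cvg_lim _ cU).
apply: (nonincreasing_cvgn_ge (expansion_tail_nonincreasing db)).
by apply/cvg_ex; exists y.
Qed.

(** A later digit other than [b - 1] makes the nonincreasing upper bounds drop strictly. The strict
    inequality is what determines the floors. *)
Lemma expansion_strict_bounds d y : (forall i, (d i < b)%N) ->
  (forall n, exists2 k, (n <= k)%N & ((d k).+1 < b)%N) ->
  expansion d @ \oo --> y -> forall n,
  expansion d n <= y < expansion d n + b%:R ^- n.
Proof.
move=> db inf cy n; have /andP[-> _] := expansion_bounds db cy n => /=.
have [k nk dk] := inf n.
apply: (lt_le_trans _ (expansion_tail_nonincreasing db nk)).
have /andP[_ yk] := expansion_bounds db cy k.+1.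
apply: (le_lt_trans yk).
rewrite expansionS (expn_invS k) -addrA ltrD2l -[X in _ + X]mul1r -mulrDl.
by rewrite ltr_pM2r // natr1 ltr_nat.
Qed.

Lemma scaled_expansionS d n : b%:R ^+ n.+1 * expansion d n.+1 =
  b%:R * (b%:R ^+ n * expansion d n) + (d n)%:R.
Proof.
rewrite expansionS mulrDr exprS mulrA; congr (_ + _).
by rewrite mulrCA -exprS divff ?mulr1 // gt_eqF // exprn_gt0.
Qed.

Lemma expansion_digit d y : (forall i, (d i < b)%N) ->
  (forall n, exists2 k, (n <= k)%N & ((d k).+1 < b)%N) ->
  expansion d @ \oo --> y ->
  scaled_floor b 0 y = 0 /\ forall i, digit b y i = d i.
Proof.
move=> db inf cy.
(* [Z n] is the integer whose base-b string is formed by the first [n] digits; the strict bounds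
   make it the floor of [b ^ n * y]. *)
pose Z := fix Z n : nat := if n is n'.+1 then (b * Z n' + d n')%N else 0%N.
have ZE n : (Z n)%:R = b%:R ^+ n * expansion d n.
  elim: n => [|n IH].
    by rewrite /expansion /series /= big_geq // mulr0.
  by rewrite scaled_expansionS -IH /= natrD natrM.
have fE n : scaled_floor b n y = Z n.
  apply: scaled_floorP; rewrite -pmulrn ZE.
  have /andP[l u] := expansion_strict_bounds db inf cy n.
  rewrite ler_pM2l ?exprn_gt0 // l /=.
  have := u; rewrite -(@ltr_pM2l _ (b%:R ^+ n)) ?exprn_gt0 // mulrDr divff //.
  by rewrite gt_eqF // exprn_gt0.
split=> [|i]; first by rewrite fE.
rewrite /digit !fE /=; lia.
Qed.

Lemma digit_frac_part x i : digit b (frac_part x) i = digit b x i.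
Proof.
have E j : scaled_floor b j (frac_part x) =
    scaled_floor b j x - b%:Z ^+ j * Num.floor x.
  apply: scaled_floorP; have := scaled_floor_itv b j x.
  rewrite rmorphB /= intrM rmorphXn /= -pmulrn /frac_part mulrBr.
  move=> /andP[? ?]; apply/andP; split; lra.
rewrite /digit !E exprS; ring.
Qed.

Lemma cvg_digit_expansion x d : (forall i, digit b x i = d i) ->
  expansion d @ \oo --> frac_part x.
Proof.
move=> dE; set y := frac_part x.
have y0 : scaled_floor b 0 y = 0.
  apply: scaled_floorP; rewrite expr0 mul1r /y /frac_part.
  by have := floor_itv x; rewrite intrD => /andP[? ?]; apply/andP; split; lra.
have E n : b%:R ^+ n * expansion d n = (scaled_floor b n y)%:~R.
  elim: n => [|n IH].
    by rewrite /expansion /series /= big_geq // mulr0 y0.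
  rewrite scaled_expansionS IH.
  have -> : scaled_floor b n.+1 y = b%:Z * scaled_floor b n y + d n.
    by rewrite -dE -digit_frac_part /digit; ring.
  by rewrite intrD intrM -!pmulrn.
have B n : y - b%:R ^- n <= expansion d n <= y.
  have /andP[l u] := scaled_floor_itv b n y; rewrite -E in l u.
  rewrite ler_pM2l ?exprn_gt0 // in l; rewrite l andbT lerBlDr.
  rewrite -(@ler_pM2l _ (b%:R ^+ n)) ?exprn_gt0 // [X in _ <= X]mulrDr divff
    ?(ltW u) //.
  by rewrite gt_eqF // exprn_gt0.
apply: (@squeeze_cvgr _ _ _ _ (fun n => y - b%:R ^- n) (fun=> y)).
- by apply: nearW.
- by rewrite -[X in _ --> X]subr0; apply: cvgB;
  [exact: cvg_cst|exact: cvg_expn_inv].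
- exact: cvg_cst.
Qed.
End Expansions.

(** * Digit frequencies *)

Section Frequencies.
Variables (R : realType) (b : nat).
Hypothesis hb : (1 < b)%N.
Implicit Types (x y : R) (i n k : nat).

Lemma exists_digit x : exists d : nat -> 'I_b, forall i, digit b x i = d i.
Proof.
suff /choice[d dE] : forall i, exists z : 'I_b, digit b x i = z by exists d.
move=> i; have /andP[ge0 ltb] := digit_itv hb x i.
have lt : (absz (digit b x i) < b)%N by lia.
by exists (Ordinal lt) => /=; lia.
Qed.

(** Trailing digits [b - 1] add up to one unit of the preceding place, so for [i >= n] the number
    [b ^ i * y] is the integer [Z i + 1], and the digits given by floors are [e i + 1 - b = 0]. *)
Lemma eventually_max_digit_expansion (e : nat -> nat) y n :
  (forall k, (n <= k)%N -> (e k).+1 = b) -> expansion R b e @ \oo --> y ->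
  forall i, (n <= i)%N -> digit b y i = 0.
Proof.
move=> emax cy.
have b_gt0 : 0 < b%:R :> R by rewrite ltr0n ltnW.
have E i : (n <= i)%N -> y = expansion R b e i + b%:R ^- i.
  have cst j : (n <= j)%N ->
      expansion R b e j + b%:R ^- j = expansion R b e n + b%:R ^- n.
    move=> nj; rewrite -(subnK nj); elim: (j - n)%N => [//|m <-].
    rewrite addSn expansionS (expn_invS R hb (m + n)) -addrA; congr (_ + _).
    rewrite -[X in _ + X]mul1r -mulrDl natr1 emax //; lia.
  move=> /cst ->; apply/esym.
  have : (fun n => expansion R b e n + b%:R ^- n) @ \oo --> y.
    by rewrite -[y]addr0; apply: cvgD => //; exact: cvg_expn_inv.
  apply: cvg_unique => //; apply: cvg_near_cst.
  by exists n => // j; exact: cst.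
pose Z := fix Z n : nat := if n is n'.+1 then (b * Z n' + e n')%N else 0%N.
have ZE i : (Z i)%:R = b%:R ^+ i * expansion R b e i :> R.
  elim: i => [|i IH].
    by rewrite /expansion /series /= big_geq // mulr0.
  by rewrite scaled_expansionS // -IH /= natrD natrM.
have fE i : (n <= i)%N -> scaled_floor b i y = (Z i).+1.
  move=> ni; apply: scaled_floorP; rewrite (E i ni) mulrDr divff.
    by rewrite -ZE -pmulrn natr1 lexx ltrDl ltr01.
  by rewrite gt_eqF // exprn_gt0.
move=> i ni; rewrite /digit !fE //=; last by lia.
have := emax i ni; lia.
Qed.

(** An expansion that does not end in digits [b - 1] consists of the digits given by floors; one
    that does makes those digits vanish from some place on. Hence the rule for choosing between two
    expansions selects the digits given by floors. *)
Lemma digit_sequenceP x (d : nat -> 'I_b) :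
  digit_sequence x d <-> forall i, digit b x i = d i.
Proof.
have db (e : nat -> 'I_b) i : (e i < b)%N by [].
split=> [[cd fin] i|dE].
  have [D DE] := exists_digit x.
  have [->//|/eqP dD] := pselect (d = D).
  have cD : base_expansion (frac_part x) D by exact: (cvg_digit_expansion hb
    DE).
  have /fin /finite_seqP[s sE] : exists2 e : nat -> 'I_b,
      base_expansion (frac_part x) e & e <> d.
    by exists D => // /esym /eqP; rewrite (negbTE dD).
  have [|_ <-] := expansion_digit hb (db d) _ cd;
    last by rewrite digit_frac_part.
  (* Past its last nonzero digit [d] is 0, which is not the maximal digit because [b >= 2]. *)
  move=> n; pose N := (\max_(j <- s) j).+1.
  exists (maxn n N); first exact: leq_maxl.
  have -> : d (maxn n N) = 0%N :> nat; last by [].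
  apply/eqP; apply: contrapT => /negP dN0.
  have : [set i | (d i != 0 :> nat)%N] (maxn n N) by [].
  rewrite sE /= => /(@leq_bigmax_seq _ s xpredT id) /(_ isT) /=.
  by rewrite leqNgt leq_max /N ltnSn orbT.
split; first exact: (cvg_digit_expansion hb dE).
move=> [e ce ed].
have [inf|/existsNP[n notmax]] :=
  pselect (forall n, exists2 k, (n <= k)%N & ((e k).+1 < b)%N).
  have [_ eE] := expansion_digit hb (db e) inf ce.
  exfalso; apply: ed; apply/funext => i; apply/val_inj.
  by have := eE i; rewrite digit_frac_part // dE => -[].
apply: (@sub_finite_set _ _ `I_n); last exact: finite_II.
move=> i /= di; rewrite ltnNge; apply/negP => ni.
have : digit b (frac_part x) i = 0.
  apply: (@eventually_max_digit_expansion e _ n) => // k nk.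
  have := db e k; rewrite leq_eqVlt => /orP[/eqP//|lt].
  by exfalso; apply: notmax; exists k.
by rewrite digit_frac_part // dE => -[] /eqP; rewrite (negbTE di).
Qed.

Definition digit_count x k n : nat := \sum_(i < n) (digit b x i == k%:Z).

Definition digit_freq x k : R^nat := fun n => (digit_count x k n)%:R / n%:R.

Lemma digit_countS x k n :
  digit_count x k n.+1 = (digit_count x k n + (digit b x n == k%:Z))%N.
Proof. by rewrite /digit_count big_ord_recr. Qed.

Lemma digit_count_total x n : (\sum_(k < b) digit_count x k n = n)%N.
Proof.
elim: n => [|n IH].
  by rewrite big1 // => k _; rewrite /digit_count big_ord0.
under eq_bigr do rewrite digit_countS.
rewrite big_split /= IH -addn1; congr (_ + _)%N.
have [d dE] := exists_digit x.
rewrite (bigD1 (d n)) //= dE eqxx big1 // => k.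
by rewrite eq_sym eqz_nat -val_eqE => /negbTE ->.
Qed.

(** Limits of frequencies are nonnegative, and they sum to 1 because the counts up to [n] add up to
    [n]. So only convergence remains to be asked. *)
Lemma BE_P x :
  @BE R b x <-> forall k, (k < b)%N -> cvgn (digit_freq x k).
Proof.
have freqE (d : nat -> 'I_b) (k : 'I_b) : (forall i, digit b x i = d i) ->
    (fun n => #|[pred i : 'I_n | d i == k]|%:R / n%:R : R) = digit_freq x k.
  move=> dE; apply/funext => n; rewrite /digit_freq -sum1_card big_mkcond.
  by congr (_%:R / _); apply: eq_bigr => i _; rewrite dE eqz_nat /= val_eqE.
split=> [[alpha _ [d /digit_sequenceP dE fd]] k kb|cf].
  apply/cvg_ex; exists (alpha (Ordinal kb)).
  by have := fd (Ordinal kb); rewrite /has_digit_frequency freqE.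
have [d dE] := exists_digit x.
pose alpha (k : 'I_b) := limn (digit_freq x k).
have ca (k : 'I_b) : digit_freq x k @ \oo --> alpha k by exact: (cf k).
exists alpha; last first.
  exists d; first exact/digit_sequenceP.
  by move=> k; rewrite /has_digit_frequency freqE //; exact: ca.
split=> [k|].
  apply: limr_ge; first exact: cf.
  by apply: nearW => n; rewrite /digit_freq divr_ge0.
have : (\sum_(k < b) digit_freq x k n) @[n --> \oo] --> \sum_(k < b) alpha k.
  elim: (index_enum _) => [|k s IH].
    by under eq_fun do rewrite big_nil; rewrite big_nil; exact: cvg_cst.
  by under eq_fun do rewrite big_cons; rewrite big_cons; exact: cvgD.
move/cvg_lim => <- //; apply/cvg_lim => //; apply: cvg_near_cst.
(* At [n = 0] all quotients are 0 by convention, so the sum is 1 only from [n = 1] on. *)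
exists 1%N => // n /= n1; rewrite /digit_freq -mulr_suml -natr_sum.
by rewrite digit_count_total divff // pnatr_eq0; lia.
Qed.
End Frequencies.

(** * Measurability *)

Section Measurability.
Variables (R : realType) (b : nat).
Hypothesis hb : (1 < b)%N.
Implicit Types (x y : R) (i n k : nat).

Lemma eq_scaled_floor_digit x y n i : scaled_floor b n x = scaled_floor b n y ->
  (i < n)%N -> digit b x i = digit b y i.
Proof.
move=> xy lt_in; have lt' : (n - i.+1 < n)%N by lia.
have E : (n - (n - i.+1).+1 = i)%N by lia.
have := digit_scaled_floor hb x lt'; have := digit_scaled_floor hb y lt'.
by rewrite E xy => -> ->.
Qed.

Lemma eq_scaled_floor_count x y n i k :
  scaled_floor b n x = scaled_floor b n y -> (i <= n)%N ->
  digit_count b x k i = digit_count b y k i.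
Proof.
move=> xy le_in; apply: eq_bigr => j _; congr (nat_of_bool (_ == _)).
by apply: eq_scaled_floor_digit xy _; have := ltn_ord j; lia.
Qed.

Lemma measurable_scaled_floor_level n (z : int) :
  measurable [set x : R | scaled_floor b n x = z].
Proof.
have -> : [set x : R | scaled_floor b n x = z] =
    (fun x => b%:R ^+ n * x) @^-1` `[z%:~R, z%:~R + 1[%classic.
  apply/seteqP; split=> x /=; rewrite in_itv /=.
    by move=> <-; exact: scaled_floor_itv.
  exact: scaled_floorP.
rewrite -[X in measurable X]setTI.
have : measurable_fun setT (fun x : R => b%:R ^+ n * x).
  exact: mulrl_measurable.
by apply.
Qed.

(** Such a set is a countable union of half-open intervals on which [scaled_floor b n] is
    constant. *)
Lemma measurable_scaled_floor n (P : set R) :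
  (forall x y, scaled_floor b n x = scaled_floor b n y -> P x -> P y) ->
  measurable P.
Proof.
move=> Peq.
have -> : P = \bigcup_(z in scaled_floor b n @` P)
    [set x | scaled_floor b n x = z].
  apply/seteqP; split=> [x Px|x [_ [y Py <-]] /= xy].
    by exists (scaled_floor b n x) => //; exists x.
  exact: Peq (esym xy) Py.
rewrite bigcup_mkcond; apply: countable_bigcupT_measurable => //.
by move=> z; case: ifP => _ //; exact: measurable_scaled_floor_level.
Qed.

(** The countably many precisions [1 / (q + 1)] serve twice: they make [BE] measurable, and they
    split its complement into countably many pieces. *)
Lemma cvgn_cauchyP (u : R^nat) : cvgn u <-> forall q : nat, exists N : nat,
  forall n m, (N <= n)%N -> (N <= m)%N -> `|u n - u m| <= q.+1%:R^-1.
Proof.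
split=> [cu q|cu].
  have q0 : 0 < (q.+1%:R^-1 / 2 : R) by rewrite divr_gt0.
  have /cvgrPdist_le/(_ _ q0)[N _ hN] := cu; exists N => n m Nn Nm.
  have := hN n Nn; have := hN m Nm.
  move: (limn u) (q.+1%:R^-1 : R) => l c /=; rewrite !ler_norml.
  move=> /andP[? ?] /andP[? ?]; apply/andP; split; lra.
apply/cauchy_cvgP/cauchy_exP => e e0.
have [N hN] := cu (Num.trunc e^-1).
exists (u N); exists N => // n /= Nn; rewrite -ball_normE /ball_ /=.
apply: le_lt_trans (hN _ _ (leqnn N) Nn) _.
by rewrite invf_plt ?posrE // truncnS_gt.
Qed.

Lemma measurable_BE : measurable (@BE R b).
Proof.
have -> : @BE R b = \bigcap_(k in `I_b) \bigcap_q \bigcup_N \bigcap_(n in [set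
  n | (N <= n)%N])
   \bigcap_(m in [set m | (N <= m)%N])
   [set x | `|digit_freq b x k n - digit_freq b x k m| <= q.+1%:R^-1].
  apply/seteqP; split=> x /=.
    move=> /(BE_P hb) cx k kb q _; have /cvgn_cauchyP/(_ q)[N hN] := cx k kb.
    by exists N => // n Nn m Nm; exact: hN.
  move=> cx; apply/(BE_P hb) => k kb; apply/cvgn_cauchyP => q.
  by have [N _ hN] := cx k kb q I; exists N => n m Nn Nm; exact: hN.
apply: bigcap_measurableType => // k _; apply: bigcap_measurable => // q _.
apply: bigcup_measurable => N _; apply: bigcap_measurableType => n _.
apply: bigcap_measurableType => m _.
apply: (measurable_scaled_floor (n := maxn n m)) => x y xy /=.
by rewrite /digit_freq !(eq_scaled_floor_count _ xy) ?leq_maxl ?leq_maxr.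
Qed.

(** The difference of two such limits is the asymptotic count of the digit in a window between two
    multiples of [2 ^ m], in units of [2 ^ m]. *)
Lemma cvg_window_count x k (a : R) v : (0 < v)%N ->
  digit_freq b x k @ \oo --> a ->
  ((digit_count b x k (v * 2 ^ m)%N)%:R / (2 ^ m)%N%:R : R) @[m --> \oo] --> a
    * v%:R.
Proof.
move=> v0 ca.
have cv : (fun m => digit_freq b x k (v * 2 ^ m)%N) @ \oo --> a.
  apply: cvg_comp ca; apply/cvgnyPge => A; exists A => // m /= Am.
  by apply: leq_trans (leq_pmull _ v0); apply: leq_trans Am (ltnW (ltn_expl _
    _)).
rewrite (_ : (fun m => _) = (fun m => digit_freq b x k (v * 2 ^ m)%N * v%:R)).
  by apply: cvgMl.
apply/funext => m; have : (0 < 2 ^ m)%N by rewrite expn_gt0.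
rewrite /digit_freq; move: (2 ^ m)%N => p p0; rewrite natrM invfM.
by rewrite [v%:R^-1 * _]mulrC mulrA divfK // pnatr_eq0 -lt0n.
Qed.

End Measurability.

(** * Adding a number with few nonzero digits *)

Section Carries.
Variables (R : realType) (b : nat).
Hypothesis hb : (1 < b)%N.
Implicit Types (x y z s : R) (i j n k m u r v q : nat).

Lemma digit_count_interval x k n1 n2 :
  (forall i, (n1 <= i < n2)%N -> digit b x i = k) -> (n1 <= n2)%N ->
  digit_count b x k n2 = (digit_count b x k n1 + (n2 - n1))%N.
Proof.
move=> dk /subnK; move: (n2 - n1)%N => d E; rewrite -E in dk *.
elim: d {E} dk => [|d IH] dk; first by rewrite addn0.
rewrite addSn digit_countS IH ?dk ?eqxx /=; first by lia.
  by lia.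
by move=> i hi; apply: dk; lia.
Qed.

(** Where [y] has digit 0, a carry goes out only if [x] has digit [b - 1] and a carry comes in; the
    sum then has digit 0. *)
Lemma carry_zero_digit x y i : digit b y i = 0 -> digit b (x + y) i != 0 ->
  carry b x y i = 0.
Proof.
have := digitD b x y i; have := digit_itv hb x i; have := carry_itv hb x y i.
have := carry_itv hb x y i.+1; have := digit_itv hb (x + y) i.
move=> dxy c' c dx E y0; rewrite E y0 in dxy *.
have : carry b x y i = 0 \/ carry b x y i = 1 by lia.
by move=> [->//|c1]; rewrite c1 in dxy *; lia.
Qed.

Lemma carry_propagate x y i : digit b y i = 0 -> carry b x y i.+1 = 0 ->
  carry b x y i = 0.
Proof.
have := digitD b x y i; have := digit_itv hb x i; have := carry_itv hb x y i.
have := digit_itv hb (x + y) i.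
move=> dxy c dx E y0 c0; move: E; rewrite y0 c0.
have : carry b x y i = 0 \/ carry b x y i = 1 by lia.
by move=> [->//|->]; lia.
Qed.

Lemma carry_propagate_interval x y n1 n2 :
  (forall i, (n1 <= i < n2)%N -> digit b y i = 0) ->
  carry b x y n2 = 0 -> forall i, (n1 <= i <= n2)%N -> carry b x y i = 0.
Proof.
move=> y0 c0 i /andP[n1i /subnKC E]; move: (n2 - i)%N E => d.
elim: d i n1i => [|d IH] i n1i E; first by rewrite -c0 -E addn0.
apply: carry_propagate; first by apply: y0; lia.
by apply: IH; lia.
Qed.

Lemma digitD_no_carry x y i : digit b y i = 0 -> carry b x y i = 0 ->
  carry b x y i.+1 = 0 -> digit b (x + y) i = digit b x i.
Proof. by move=> y0 c0 c1; rewrite digitD y0 c0 c1; lia. Qed.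

(** The witness is the integer part of the binary logarithm of [n / r]. These dyadic eras tile the
    positions from [r] on. *)
Lemma era_exists r m0 n : (0 < r)%N -> (r * 2 ^ m0 <= n)%N ->
  exists2 m, (m0 <= m)%N & (r * 2 ^ m <= n < r * 2 ^ m.+1)%N.
Proof.
move=> r0 le_n; have m0n : (2 ^ m0 <= n %/ r)%N by rewrite leq_divRL // mulnC.
have nr0 : (0 < n %/ r)%N by apply: leq_trans m0n; rewrite expn_gt0.
exists (trunc_log 2 (n %/ r)); first exact: trunc_log_max.
have /andP[l h] := trunc_log_bounds (ltnSn 1) nr0.
by rewrite mulnC -leq_divRL // l mulnC -ltn_divLR.
Qed.

Definition digit_diff x y n : nat := \sum_(i < n) (digit b x i != digit b y i).

Lemma digit_diffS x y n :
  digit_diff x y n.+1 = (digit_diff x y n + (digit b x n != digit b y n))%N.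
Proof. by rewrite /digit_diff big_ord_recr. Qed.

Lemma digit_diffC x y n : digit_diff x y n = digit_diff y x n.
Proof. by apply: eq_bigr => i _; rewrite eq_sym. Qed.

Lemma digit_count_diff x y k n :
  (digit_count b x k n <= digit_count b y k n + digit_diff x y n)%N.
Proof.
rewrite /digit_count /digit_diff -big_split /=; apply: leq_sum => i _.
have [->|_] := eqVneq (digit b x i) (digit b y i); first by rewrite leq_addr.
by rewrite (leq_trans (leq_b1 _)) ?leq_addl.
Qed.

Lemma digit_diff_interval x y n1 n2 : (n1 <= n2)%N ->
  (digit_diff x y n2 <= digit_diff x y n1 + (n2 - n1))%N.
Proof.
move=> /subnK; move: (n2 - n1)%N => d <-; elim: d => [|d IH].
  by rewrite add0n leq_addr.
rewrite addSn digit_diffS; apply: leq_trans (leq_add IH (leq_b1 _)) _.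
by rewrite addn1 addnS.
Qed.

Lemma digit_diff_eq_interval x y n1 n2 : (n1 <= n2)%N ->
  (forall i, (n1 <= i < n2)%N -> digit b x i = digit b y i) ->
  digit_diff x y n2 = digit_diff x y n1.
Proof.
move=> /subnK; move: (n2 - n1)%N => d <-; elim: d => [|d IH] // E.
rewrite addSn digit_diffS E ?eqxx ?addn0 ?IH //; last by lia.
by move=> i ?; apply: E; lia.
Qed.

(* A nonzero digit of [x + y] where [y] vanishes stops the carries coming from
    its right. As the frequency of the digit 0 in [x + y] is not 1, there is one
   in [(2 u - 2) 2^m, 2 u 2^m) for large m, so within [u 2^m, 2 u 2^m) only the
   first 2 2^m and the last 2 2^m digits can change; 8 = 4 * 2 as these counts
   add up over m. *)
Lemma sparse_perturbation x y u (a : R) : (4 <= u)%N ->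
  (forall m i, ((u + 2) * 2 ^ m <= i < u * 2 ^ m.+1)%N -> digit b y i = 0) ->
  digit_freq b (x + y) 0 @ \oo --> a -> a != 1 ->
  exists K, forall n, (u * digit_diff x (x + y) n <= K + 8 * n)%N.
Proof.
move=> u4 y0 ca a1.
have [M guard] : exists M, forall m, (M <= m)%N ->
    exists2 j, ((2 * u - 2) * 2 ^ m <= j < u * 2 ^ m.+1)%N &
      digit b (x + y) j != 0.
  have c1 : (fun m => (digit_count b (x + y) 0 (u.*2 * 2 ^ m)%N)%:R / (2 ^
    m)%N%:R -
      (digit_count b (x + y) 0 ((2 * u - 2) * 2 ^ m)%N)%:R / (2 ^ m)%N%:R) @
        \oo -->
      a * 2.
    have -> : a * 2 = a * u.*2%:R - a * (2 * u - 2)%N%:R.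
      by rewrite -mulrBr -natrB; [congr (_ * _%:R)|]; lia.
    by apply: cvgB; apply: cvg_window_count => //; lia.
  have a2 : 0 < `|a * 2 - 2|.
    by rewrite normr_gt0 subr_eq0 -[X in _ != X]mul1r (inj_eq (mulIf _)) //
      pnatr_eq0.
  have /cvgrPdist_lt/(_ _ a2)[M _ hM] := c1.
  exists M => m /hM /= lt2; apply: contrapT => no.
  suff E2 : (digit_count b (x + y) 0 (u.*2 * 2 ^ m)%N)%:R / (2 ^ m)%N%:R -
      (digit_count b (x + y) 0 ((2 * u - 2) * 2 ^ m)%N)%:R / (2 ^ m)%N%:R = 2
        :> R.
    by rewrite E2 ltxx in lt2.
  have E : (u * 2 ^ m.+1 = u.*2 * 2 ^ m)%N by rewrite expnS; lia.
  rewrite E in no.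
  rewrite (@digit_count_interval _ 0 ((2 * u - 2) * 2 ^ m)%N); last by nia.
    rewrite -mulnBl natrD mulrDl addrC addKr natrM.
    have -> : (u.*2 - (2 * u - 2) = 2)%N by lia.
    by rewrite mulfK // pnatr_eq0 -lt0n expn_gt0.
  move=> i hi; apply/eqP; apply: contrapT => /negP ne; apply: no.
  by exists i => //; lia.
have stable m i : (M <= m)%N -> ((u + 2) * 2 ^ m <= i < (2 * u - 2) * 2 ^ m)%N
  ->
    digit b x i = digit b (x + y) i.
  move=> /guard[j jm dj] im; have := jm; rewrite expnS => jm'.
  have y0j l : ((u + 2) * 2 ^ m <= l < j.+1)%N -> digit b y l = 0.
    move=> hl; apply: (y0 m); lia.
  have cj : carry b x y j = 0.
    by apply: carry_zero_digit => //; apply: y0j; nia.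
  have cl l : ((u + 2) * 2 ^ m <= l <= j)%N -> carry b x y l = 0.
    by apply: carry_propagate_interval => // ? ?; apply: y0j; lia.
  by rewrite digitD_no_carry //; [apply: y0j|apply: cl|apply: cl]; lia.
pose D := digit_diff x (x + y).
have step m : (M <= m)%N -> (D (u * 2 ^ m.+1)%N <= D (u * 2 ^ m)%N + 4 * 2 ^
  m)%N.
  move=> Mm; rewrite expnS.
  have h1 : (D ((u + 2) * 2 ^ m)%N <= D (u * 2 ^ m)%N + 2 * 2 ^ m)%N.
    have le : (u * 2 ^ m <= (u + 2) * 2 ^ m)%N by rewrite leq_mul2r leq_addr
      orbT.
    by have := digit_diff_interval x (x + y) le; rewrite -mulnBl addKn.
  have h2 : D ((2 * u - 2) * 2 ^ m)%N = D ((u + 2) * 2 ^ m)%N.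
    apply: digit_diff_eq_interval; first by rewrite leq_mul2r; apply/orP;
      right; lia.
    by move=> i; exact: stable.
  have h3 : (D (u * (2 * 2 ^ m))%N <= D ((2 * u - 2) * 2 ^ m)%N + 2 * 2 ^ m)%N.
    rewrite mulnA [(u * 2)%N]mulnC.
    have le : ((2 * u - 2) * 2 ^ m <= 2 * u * 2 ^ m)%N by rewrite leq_mul2r
      leq_subr orbT.
    have := digit_diff_interval x (x + y) le; rewrite -mulnBl.
    by have -> : (2 * u - (2 * u - 2) = 2)%N by lia.
  lia.
have bound m : (M <= m)%N -> (D (u * 2 ^ m)%N <= D (u * 2 ^ M)%N + 4 * 2 ^ m)%N.
  move=> /subnK <-; elim: (m - M)%N => [|d IH]; first by rewrite add0n leq_addr.
  have := step (d + M)%N (leq_addl _ _); rewrite addSn => h.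
  apply: leq_trans h _; rewrite [X in (_ <= _ + 4 * X)%N]expnS; lia.
exists (u * D (u * 2 ^ M)%N)%N => n.
have Dmono n1 n2 : (n1 <= n2)%N -> (D n1 <= D n2)%N.
  move=> /subnK <-; elim: (n2 - n1)%N => // d IH.
  by rewrite addSn /D digit_diffS (leq_trans IH) // leq_addr.
have [lt|le] := ltnP n (u * 2 ^ M)%N.
  by apply: leq_trans (leq_addr _ _); rewrite leq_mul2l Dmono ?orbT // ltnW.
have [m Mm /andP[l h]] : exists2 m, (M <= m)%N & (u * 2 ^ m <= n < u * 2 ^
  m.+1)%N.
  by apply: era_exists => //; lia.
have := leq_trans (Dmono _ _ (ltnW h)) (bound m.+1 (leqW Mm)).
rewrite -(leq_pmul2l (m := u)); last by lia.
move=> /leq_trans; apply; rewrite expnS mulnDr leq_add2l; lia.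
Qed.

(** On each pair of positions at most three of the four digits of [z] and [z + s] are 0: if [z] has
    digits 0, 0, no carry comes out of the second place, and the digit 1 of [s] shows up in [z + s].
    So 0 cannot have frequency 1 in both numbers. *)
Lemma alternating_shift z s : forall n1 n2, (n1 <= n2)%N ->
  (forall j, (n1 <= j < n2)%N -> digit b s j.*2 = 1 /\ digit b s j.*2.+1 = 0) ->
  (digit_count b z 0 n2.*2 + digit_count b (z + s) 0 n2.*2 <=
   digit_count b z 0 n1.*2 + digit_count b (z + s) 0 n1.*2 + 3 * (n2 - n1))%N.
Proof.
move=> n1 n2 /subnK; move: (n2 - n1)%N => d <-.
elim: d => [|d IH] hs; first by rewrite add0n leq_addr.
have {}IH : (digit_count b z 0 (d + n1).*2 + digit_count b (z + s) 0 (d +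
  n1).*2 <=
   digit_count b z 0 n1.*2 + digit_count b (z + s) 0 n1.*2 + 3 * d)%N.
  by apply: IH => j hj; apply: hs; lia.
rewrite addSn doubleS !digit_countS.
have [] := hs (d + n1)%N; first by lia.
move: IH; set i := (d + n1).*2 => IH s1 s0.
have pair : ~ [/\ digit b z i = 0, digit b z i.+1 = 0 & digit b (z + s) i = 0].
  move=> [z0 z1 zs].
  have c1 : carry b z s i.+1 = 0.
    have := carry_itv hb z s i.+2; have := carry_itv hb z s i.+1.
    have := digit_itv hb (z + s) i.+1; rewrite digitD z1 s0.
    move: (carry b z s i.+2) (carry b z s i.+1) => c2 c1 d1 h1 h2.
    have [//|E] : c1 = 0 \/ c1 = 1 by lia.
    by rewrite E in d1; lia.
  have := carry_itv hb z s i; move: zs; rewrite digitD z0 s1 c1.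
  move: (carry b z s i) => c0 d0 h0.
  have [E|E] : c0 = 0 \/ c0 = 1 by lia.
    by rewrite E in d0; lia.
  by rewrite E in d0; lia.
have {}pair : ((digit b z i == 0) + (digit b z i.+1 == 0) +
    (digit b (z + s) i == 0) <= 2)%N.
  move: pair; case: eqP => //= z0; case: eqP => //= z1; case: eqP => //= zs.
  by move=> h; exfalso; apply: h.
have := leq_b1 (digit b (z + s) i.+1 == 0).
move: pair IH; rewrite -/(i.+1).
move: (nat_of_bool (digit b z i == 0)) (nat_of_bool (digit b z i.+1 == 0)).
move: (nat_of_bool (digit b (z + s) i == 0)) => ? ? ?.
move: (nat_of_bool (digit b (z + s) i.+1 == 0)) => ?.
lia.
Qed.
End Carries.

(** * Equidistributed blocks *)

Section Oscillation.
Variables (R : realType) (b : nat).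
Hypothesis hb : (1 < b)%N.
Implicit Types (x y z s : R) (i j n k m r v q : nat).

Definition cauchy_at (u : R^nat) q := exists N : nat,
  forall n m, (N <= n)%N -> (N <= m)%N -> `|u n - u m| <= q.+1%:R^-1.

(** With [e = 1 / (q + 1)], the bound on [r] gives [8 / r <= e / 4]; for large [n] both [K / n] and
    the distance from [v n] to [l] are at most [e / 8]. So [u n] is within [e / 2] of [l], although
    [u] itself may diverge. *)
Lemma cauchy_at_close (u v : R^nat) (l K : R) r q :
  v @ \oo --> l -> (32 * q.+1 <= r)%N ->
  (forall n, (0 < n)%N -> `|u n - v n| <= K / n%:R + 8 / r%:R) ->
  cauchy_at u q.
Proof.
move=> cv qr uv; have e0 : 0 < q.+1%:R^-1 / 8 :> R by rewrite divr_gt0.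
have q0 : q.+1%:R^-1 / 8 * q.+1%:R = 8^-1 :> R.
  by rewrite mulrAC mulVf ?mul1r // pnatr_eq0.
have r8 : 8 / r%:R <= q.+1%:R^-1 / 4 :> R.
  rewrite ler_pdivrMr; last by rewrite ltr0n; lia.
  have : 32 * q.+1%:R <= r%:R :> R by rewrite -natrM ler_nat.
  move=> /(ler_wpM2l (ltW e0)); rewrite mulrCA q0;
    move: (q.+1%:R^-1 : R) => e; lra.
have /cvgrPdist_le/(_ _ e0)[N1 _ h1] := cv.
have [N2 h2] : exists N2, forall n, (N2 < n)%N -> K / n%:R <= q.+1%:R^-1 / 8.
  exists (Num.trunc (8 * K * q.+1%:R)) => n nN.
  have n0 : (0 < n)%N by lia.
  rewrite ler_pdivrMr ?ltr0n //.
  have : 8 * K * q.+1%:R <= n%:R.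
    by apply/ltW/(lt_le_trans (truncnS_gt _)); rewrite ler_nat.
  move=> /(ler_wpM2l (ltW e0)); rewrite mulrCA q0;
    move: (q.+1%:R^-1 : R) => e; lra.
have close n : (maxn N1 N2.+1 <= n)%N -> `|u n - l| <= q.+1%:R^-1 / 2.
  rewrite geq_max => /andP[n1 n2].
  have := h1 n n1; have := h2 n n2; have := uv n (leq_trans (ltn0Sn _) n2) =>
    /=.
  move: (K / _) (8 / _) (q.+1%:R^-1 : R) r8 => c d e r8.
  rewrite !ler_norml => /andP[? ?] ? /andP[? ?]; apply/andP; split; lra.
exists (maxn N1 N2.+1) => n m /close + /close.
move: (q.+1%:R^-1 : R) => e; rewrite !ler_norml.
by move=> /andP[? ?] /andP[? ?]; apply/andP; split; lra.
Qed.

(** This is [b * n] times the deviation of the frequency of [k] from [1 / b], which keeps the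
    estimates in the integers. *)
Definition discrepancy x k n : int := b%:Z * (digit_count b x k n)%:Z - n%:Z.

Definition balanced x k r v m : bool :=
  r%:Z * `|discrepancy x k (v.+1 * 2 ^ m)%N - discrepancy x k (v * 2 ^ m)%N| <=
    (2 ^ m)%N%:Z.

Lemma discrepancy_step x k n d :
  `|discrepancy x k (n + d)%N - discrepancy x k n| <= b%:Z * d%:Z.
Proof.
elim: d => [|d IH]; first by rewrite addn0 subrr normr0 mulr0.
rewrite addnS /discrepancy digit_countS; rewrite /discrepancy in IH.
by case: (digit b x (n + d)%N == k%:Z) => /=; lia.
Qed.

(** The blocks with [r <= v < 2 * r] tile all positions from [r * 2 ^ M] on, so their small
    discrepancies add up. The incomplete last block is shorter than [2 ^ m <= n / r]. The frequency
    thus stays within about [(b + 1) / (b * r)] of [1 / b]. *)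
Lemma balanced_cauchy_at x k r q : (32 * q.+1 <= r)%N ->
  (forall v, (r <= v < 2 * r)%N ->
     exists m0, forall m, (m0 <= m)%N -> balanced x k r v m) ->
  cauchy_at (digit_freq b x k) q.
Proof.
move=> qr bal; have r0 : (0 < r)%N by lia.
have [M hM] : exists M, forall v m, (r <= v < 2 * r)%N -> (M <= m)%N ->
    balanced x k r v m.
  have /choice[M hM] : forall v, exists m0, (r <= v < 2 * r)%N ->
      forall m, (m0 <= m)%N -> balanced x k r v m.
    move=> v; have [vr|] := boolP (r <= v < 2 * r)%N; last by exists 0%N.
    by have [m0 h] := bal v vr; exists m0.
  exists (\max_(v < 2 * r) M v) => v m vr Mm; apply: (hM v vr).
  have /andP[_ vlt] := vr.
  by apply: leq_trans Mm; exact: (leq_bigmax (Ordinal vlt)).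
pose X := discrepancy x k.
have bound v m : (r <= v <= 2 * r)%N -> (M <= m)%N ->
    r%:Z * `|X (v * 2 ^ m)%N| <=
      r%:Z * `|X (r * 2 ^ M)%N| + (v * 2 ^ m)%N%:Z.
  (* The bound passes from block to block within an era; at [v0 = 2 * r] it reaches the start of the
     next era. *)
  have inner v0 m0 : (M <= m0)%N -> r%:Z * `|X (r * 2 ^ m0)%N| <=
      r%:Z * `|X (r * 2 ^ M)%N| + (r * 2 ^ m0)%N%:Z -> (r <= v0 <= 2 * r)%N ->
      r%:Z * `|X (v0 * 2 ^ m0)%N| <=
      r%:Z * `|X (r * 2 ^ M)%N| + (v0 * 2 ^ m0)%N%:Z.
    move=> Mm0 h0 /andP[/subnKC <-]; move: (v0 - r)%N => d.
    elim: d => [|d IH] hd; first by rewrite addn0.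
    have {}IH : r%:Z * `|X ((r + d) * 2 ^ m0)%N| <=
        r%:Z * `|X (r * 2 ^ M)%N| + ((r + d) * 2 ^ m0)%N%:Z by apply: IH; lia.
    have h : balanced x k r (r + d) m0 by apply: hM => //; lia.
    rewrite /balanced -/X in h; rewrite addnS.
    have tri : r%:Z * `|X ((r + d).+1 * 2 ^ m0)%N| <=
        r%:Z * `|X ((r + d).+1 * 2 ^ m0)%N - X ((r + d) * 2 ^ m0)%N| +
        r%:Z * `|X ((r + d) * 2 ^ m0)%N|.
      rewrite -mulrDr ler_pM2l; last by lia.
      lia.
    by apply: le_trans tri _; rewrite mulSn PoszD addrCA; exact: lerD h IH.
  move=> vr Mm; apply: (inner v m Mm _ vr) => {v vr}.
  move: Mm => /subnK <-; elim: (m - M)%N => [|d IH];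
    first by rewrite add0n lerDl.
  have := inner (2 * r)%N (d + M)%N (leq_addl _ _) IH.
  by rewrite addSn expnS mulnCA mulnA; apply; lia.
(* The sum covers the finitely many [n] before the first balanced era. *)
pose K : int := r%:Z * `|X (r * 2 ^ M)%N| + (\sum_(n < r * 2 ^ M) r%:Z * `|X
  n|).
have Xb n : r%:Z * `|X n| <= K + (b.+1 * n)%N%:Z.
  have [lt|le] := ltnP n (r * 2 ^ M)%N.
    rewrite /K (bigD1 (Ordinal lt)) //=.
    have : 0 <= \sum_(i < r * 2 ^ M | i != Ordinal lt) r%:Z * `|X i|.
      by apply: sumr_ge0 => i _; rewrite mulr_ge0.
    have : 0 <= r%:Z * `|X (r * 2 ^ M)%N| by rewrite mulr_ge0.
    move: (_ * `|X (r * 2 ^ M)%N|) (_ * `|X n|) (\sum_(_ < _ | _) _) => A B C;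
      lia.
  have [m Mm /andP[l h]] := era_exists r0 le.
  pose v := (n %/ 2 ^ m)%N; have p0 : (0 < 2 ^ m)%N by rewrite expn_gt0.
  have rv : (r <= v)%N by rewrite leq_divRL.
  have v2r : (v < 2 * r)%N by rewrite ltn_divLR // -mulnA mulnCA -expnS.
  have E : n = (v * 2 ^ m + n %% 2 ^ m)%N by exact: divn_eq.
  have small := ltn_pmod n p0.
  have hv : r%:Z * `|X (v * 2 ^ m)%N| <= r%:Z * `|X (r * 2 ^ M)%N| + (v * 2 ^
    m)%N%:Z.
    by apply: bound => //; lia.
  have := discrepancy_step x k (v * 2 ^ m)%N (n %% 2 ^ m)%N;
    rewrite -E -/X => hd.
  have S0 : 0 <= \sum_(n < r * 2 ^ M) r%:Z * `|X n|.
    by apply: sumr_ge0 => i _; rewrite mulr_ge0.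
  have tri : r%:Z * `|X n| <= r%:Z * (b%:Z * (n %% 2 ^ m)%N%:Z) + r%:Z * `|X (v
    * 2 ^ m)%N|.
    rewrite -mulrDr ler_pM2l; last by lia.
    lia.
  have bn : (r * (b * (n %% 2 ^ m)) <= b * n)%N.
    rewrite mulnCA leq_mul2l; apply/orP; right; apply: leq_trans l.
    by rewrite leq_mul2l ltnW ?orbT.
  apply: le_trans tri _; rewrite /K mulSn.
  move: hv S0 bn; rewrite -(PoszM b) -(PoszM r (b * _)%N).
  set A := _ * `|X (r * 2 ^ M)%N|; set B := _ * `|X (v * 2 ^ m)%N|.
  set C := \sum_(_ < _) _.
  by move: A B C => A B C; lia.
have bR : 0 < b%:R :> R by rewrite ltr0n ltnW.
have rR : 0 < r%:R :> R by rewrite ltr0n.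
apply: (@cauchy_at_close _ (fun=> b%:R^-1) b%:R^-1 (K%:~R / (b%:R * r%:R)) r q)
  => //.
  exact: cvg_cst.
move=> n n0; have nR : 0 < n%:R :> R by rewrite ltr0n.
have -> : digit_freq b x k n - b%:R^-1 = (X n)%:~R / (b%:R * n%:R).
  rewrite /X /discrepancy rmorphB /= intrM -!pmulrn /digit_freq.
  by field; rewrite !gt_eqF.
rewrite normrM normfV (gtr0_norm (mulr_gt0 bR nR)) ler_pdivrMr ?mulr_gt0 //.
rewrite -(@ler_pM2l _ r%:R) // mulrDl mulrDr.
have -> : r%:R * (K%:~R / (b%:R * r%:R) / n%:R * (b%:R * n%:R)) = K%:~R :> R.
  by field; rewrite !gt_eqF.
have -> : r%:R * (8 / r%:R * (b%:R * n%:R)) = 8 * b%:R * n%:R :> R.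
  by field; rewrite !gt_eqF.
have := Xb n; rewrite -(@ler_int R) intrM intrD intr_norm -!pmulrn natrM =>
  /le_trans; apply.
rewrite lerD2l ler_pM2r // -natr1.
have : 1 < b%:R :> R by rewrite ltr1n.
lra.
Qed.
End Oscillation.

(** * Choice of the shifts in measure *)

Section Selection.
Context (d : measure_display) (T : measurableType d) (R : realType).

(** The measures of the [E j] add up to the integral of the multiplicity, which is at most [K] times
    the total mass; the smallest of them is at most the average. *)
Lemma exists_small_of_multiplicity (mu : {measure set T -> \bar R}) (N K : nat)
    (E : 'I_N -> set T) : (mu setT < +oo)%E -> (0 < N)%N ->
  (forall j, measurable (E j)) ->
  (forall x, (#|[pred j | x \in E j]| <= K)%N) ->
  exists j, (mu (E j) <= (K%:R / N%:R * fine (mu setT))%:E)%E.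
Proof.
move=> muT N0 mE EK.
have finmu A : measurable A -> (mu A)%E \is a fin_num.
  move=> mA; rewrite ge0_fin_numE //; apply: le_lt_trans muT.
  by apply: le_measure; rewrite ?inE.
have sumE : (\sum_(j < N) mu (E j) <= (K%:R * fine (mu setT))%:E)%E.
  have -> : (\sum_(j < N) mu (E j) =
      \int[mu]_x (\sum_(j < N) (\1_(E j) x)%:E)%E)%E.
    rewrite ge0_integral_sum //.
      by apply: eq_bigr => j _; rewrite integral_indic ?setIT.
    by move=> j; apply/measurable_EFinP; exact: measurable_indic.
  have KE : ((K%:R * fine (mu setT))%:E = \int[mu]_x (cst K%:R%:E x))%E.
    by rewrite integral_cst // EFinM fineK ?finmu.
  rewrite KE; apply: ge0_le_integral => //.
  - by move=> x _; apply: sume_ge0 => j _; rewrite lee_fin.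
  - by apply: emeasurable_sum => j; apply/measurable_EFinP;
    exact: measurable_indic.
  - move=> x _; rewrite sumEFin lee_fin /cst /=.
    apply: le_trans (_ : #|[pred j | x \in E j]|%:R <= _);
      last by rewrite ler_nat.
    rewrite -sum1_card natr_sum [X in _ <= X]big_mkcond /=.
    by apply: ler_sum => j _; rewrite indicE inE; case: (x \in E j).
pose f j := fine (mu (E j)).
have fE j : (f j)%:E = mu (E j) by rewrite fineK ?finmu.
pose j0 := [arg min_(j < Ordinal N0) f j]%O.
exists j0; rewrite -fE lee_fin.
have fmin j : f j0 <= f j by rewrite /j0; case: arg_minP => // i _ /(_ j isT).
rewrite -[K%:R / _ * _]mulrAC ler_pdivlMr ?ltr0n //.
apply: (@le_trans _ _ (\sum_(j < N) f j)).
  rewrite -[X in _ <= X]/(\sum_(j < N) f j) mulr_natr -[X in _ *+ X]card_ord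
    -sumr_const.
  exact: ler_sum.
by rewrite -lee_fin -sumEFin; under eq_bigr do rewrite fE.
Qed.

(** [la] is the sum of the restrictions of [mu] to the pieces [F i], with weights
    [2 ^- i.+1 / (1 + mu (F i))]; the summand 1 avoids division by 0. Averaging and Borel-Cantelli
    need such a finite measure. *)
Lemma sigma_finite_dominated (mu : {measure set T -> \bar R}) (B : set T) :
  sigma_finite B mu -> exists2 la : {measure set T -> \bar R},
    (la setT < +oo)%E &
    forall A, measurable A -> la A = 0%E -> mu (B `&` A) = 0%E.
Proof.
move=> [F BE mF]; have mF1 i : measurable (F i) by have [] := mF i.
have c_gt0 i : 0 < (2 ^ i.+1)%N%:R^-1 / (1 + fine (mu (F i))) :> R.
  by rewrite divr_gt0 ?invr_gt0 ?ltr0n ?expn_gt0 //.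
pose c i := NngNum (ltW (c_gt0 i)).
pose la_ i := mscale (c i) (mrestr mu (mF1 i)).
have laE i A : la_ i A = ((c i)%:num%:E * mu (A `&` F i))%E by [].
exists (mseries la_ 0).
  rewrite /mseries; apply: (@le_lt_trans _ _ 1%:E); last exact: ltry.
  apply: le_trans (@epsilon_trick0 R 1 xpredT ler01).
  apply: lee_nneseries => // i _.
  rewrite [X in (X <= _)%E](laE i setT) setTI /=.
  have muF : mu (F i) \is a fin_num by rewrite ge0_fin_numE //; have [] := mF i.
  rewrite -(fineK muF) -EFinM lee_fin mul1r.
  have f0 : 0 <= fine (mu (F i)) by rewrite fine_ge0.
  rewrite -[X in _ <= X]mulr1 -mulrA ler_pM2l ?invr_gt0 ?ltr0n ?expn_gt0 //.
  by rewrite mulrC ler_pdivrMr ?mul1r ?lerDr.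
move=> A mA; rewrite /= /mseries => la0.
have muFA i : mu (F i `&` A) = 0%E.
  have : la_ i A = 0%E.
    apply/eqP; rewrite eq_le measure_ge0 andbT -la0.
    rewrite (nneseriesD1 (n := i)) //= leeDl //.
    by apply: nneseries_ge0 => k _ _; rewrite [X in (_ <= X)%E](laE k A)
      mule_ge0.
  rewrite [X in X = _](laE i A) setIC => /eqP;
    rewrite mule_eq0 => /orP[|/eqP//].
  by rewrite eqe /= (gt_eqF (c_gt0 i)).
have mFA i : measurable (F i `&` A) by exact: measurableI.
rewrite BE setI_bigcupl; apply/negligibleP; first exact: bigcupT_measurable.
by apply: negligible_bigcup => i; apply/(negligibleP mu (mFA i)); exact: muFA.
Qed.

(** For each [m] separately, averaging picks an index whose set has measure at most a constant times
    [2 ^- m.+1]. These bounds are summable, so Borel-Cantelli applies. *)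
Lemma exists_null_limsup (mu : {measure set T -> \bar R}) (B : set T)
    (N K : nat -> nat) (C : R) (E : forall m, 'I_(N m) -> set T) :
  sigma_finite B mu -> (forall m, (0 < N m)%N) -> 0 <= C ->
  (forall m j, measurable (E m j)) ->
  (forall m x, (#|[pred j | x \in E m j]| <= K m)%N) ->
  (forall m, (K m)%:R / (N m)%:R <= C / (2 ^ m.+1)%N%:R) ->
  exists j : forall m, 'I_(N m),
    mu (B `&` lim_sup_set (fun m => E m (j m))) = 0%E.
Proof.
move=> sB N0 C0 mE EK KN; have [la laT dom] := sigma_finite_dominated sB.
have ex m : exists j, (la (E m j) <= ((K m)%:R / (N m)%:R * fine (la
  setT))%:E)%E.
  exact: exists_small_of_multiplicity.
exists (fun m => sval (cid (ex m))).
apply: dom.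
  apply: bigcapT_measurable => n; apply: bigcup_measurable => m _; exact: mE.
apply: lim_sup_set_cvg0 => //.
apply: (@le_lt_trans _ _ (C * fine (la setT))%:E); last exact: ltry.
have C1 : 0 <= C * fine (la setT) by rewrite mulr_ge0 // fine_ge0.
apply: le_trans (epsilon_trick0 xpredT C1).
apply: lee_nneseries => // m _.
apply: (le_trans (svalP (cid (ex m)))); rewrite lee_fin.
by rewrite [X in _ <= X]mulrAC ler_wpM2r // fine_ge0.
Qed.
End Selection.

(** * Counting digit strings by their second moment *)

Lemma PoszX (n k : nat) : (n ^ k)%N%:Z = n%:Z ^+ k.
Proof. by rewrite -[LHS]natz natrX natz. Qed.

Section DigitStrings.
Variable b : nat.
Hypothesis hb : (1 < b)%N.
Implicit Types (z e k L r : nat).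

(** The integer [z] stands for a string of [L] digits; leading zeros count as digits. *)
Definition string_count L z k : nat := \sum_(j < L) ((z %/ b ^ j) %% b == k)%N.

Lemma string_countS L z e k : (e < b)%N ->
  string_count L.+1 (z * b + e) k = ((e == k) + string_count L z k)%N.
Proof.
move=> eb; rewrite /string_count big_ord_recl expn0 divn1 modnMDl modn_small //.
congr (_ + _)%N; apply: eq_bigr => j _.
by rewrite lift0 expnS divnMA divnMDl ?(divn_small eb) ?addn0 // ltnW.
Qed.

Lemma sum_ord_mul n (f : nat -> int) :
  \sum_(z < n * b) f z = \sum_(i < n) \sum_(e < b) f (i * b + e)%N.
Proof.
elim: n => [|n IH]; first by rewrite !big_ord0.
rewrite big_ord_recr -IH /= mulSn addnC -(big_mkord xpredT f) (@big_cat_nat _ _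
  _ (n * b)) //=.
  rewrite big_mkord; congr (_ + _); rewrite -{1}[(n * b)%N]add0n big_addn addnC
    addnK big_mkord.
  by apply: eq_bigr => e _; rewrite addnC.
exact: leq_addr.
Qed.

(** This is the variance of [b] times a binomial variable with parameters [L] and [1 / b]. A further
    digit adds [b - 1] in one case and [- 1] in [b - 1] cases; the cross terms cancel. *)
Lemma sum_discrepancy_sqr L k : (k < b)%N ->
  \sum_(z < b ^ L) (b%:Z * (string_count L z k)%:Z - L%:Z) ^+ 2 =
  L%:Z * (b%:Z - 1) * (b ^ L)%N%:Z.
Proof.
move=> kb; elim: L => [|L IH].
  rewrite expn0 big_ord_recl big_ord0 /string_count big_ord0; ring.
rewrite expnSr (sum_ord_mul _ (fun z => (b%:Z * (string_count L.+1 z k)%:Z -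
  L.+1%:Z) ^+ 2)).
under eq_bigr => i _.
  have -> : \sum_(e < b) (b%:Z * (string_count L.+1 (i * b + e) k)%:Z -
    L.+1%:Z) ^+ 2 =
      b%:Z * (b%:Z * (string_count L i k)%:Z - L%:Z) ^+ 2 + b%:Z * (b%:Z - 1).
    under eq_bigr do rewrite string_countS //.
    rewrite (bigD1 (Ordinal kb)) //= eqxx.
    under eq_bigr => e ek.
      have /negbTE -> : (e != k :> nat)%N by exact: ek.
    over.
    rewrite sumr_const (_ : #|_| = b.-1); last first.
      by rewrite cardC1 card_ord.
    rewrite -mulr_natr natz -subn1 -subzn; last by lia.
    rewrite !add0n add1n -[L.+1]addn1 -[(string_count _ _ _).+1]addn1 !PoszD.
      ring.
over.
rewrite big_split /= -mulr_sumr IH sumr_const card_ord -mulr_natr natz PoszM.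
rewrite -addn1 PoszD; ring.
Qed.

Definition unbalanced r L k z : bool :=
  ~~ (r%:Z * `|b%:Z * (string_count L z k)%:Z - L%:Z| <= L%:Z).

(** Chebyshev's inequality; the proportion [r ^ 2 * b / L] is summable along [L = 2 ^ m]. *)
Lemma card_unbalanced r L k : (0 < L)%N -> (k < b)%N ->
  (#|[pred z : 'I_(b ^ L) | unbalanced r L k z]| * L <= r ^ 2 * b * b ^ L)%N.
Proof.
move=> L0 kb; set c := #|_|.
have : (c%:Z * L%:Z ^+ 2 <= r%:Z ^+ 2 * (L%:Z * (b%:Z - 1) * (b ^ L)%N%:Z)).
  rewrite -(sum_discrepancy_sqr L kb) mulr_sumr /c -sum1_card.
  rewrite (big_morph _ PoszD (erefl 0%:Z)) mulr_suml big_mkcond /=.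
  apply: ler_sum => z _; rewrite inE /unbalanced; case: ifP => [|_]; last first.
    by rewrite mulr_ge0 ?sqr_ge0.
  rewrite -ltNge mul1r -exprMn => lt.
  rewrite -[X in _ <= X]real_normK ?num_real // normrM.
  by rewrite lerXn2r ?nnegrE ?mulr_ge0 // ltW.
have -> : c%:Z * L%:Z ^+ 2 = L%:Z * (c * L)%N%:Z by rewrite PoszM; ring.
have -> : r%:Z ^+ 2 * (L%:Z * (b%:Z - 1) * (b ^ L)%N%:Z) =
    L%:Z * (r ^ 2 * b.-1 * b ^ L)%N%:Z.
  by rewrite !PoszM -subn1 -subzn; [ring|lia].
rewrite ler_pM2l; last by lia.
rewrite lez_nat => /leq_trans; apply.
by rewrite leq_mul2r leq_mul2l leq_pred !orbT.
Qed.
End DigitStrings.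

(** * Sparse shifts *)

Section SparseShifts.
Variables (R : realType) (b : nat).
Hypothesis hb : (1 < b)%N.
Implicit Types (x y z s t : R) (i j n k m r u v q a L : nat).

Lemma digit_count_window x k a L :
  digit_count b x k (a + L) = (digit_count b x k a +
    string_count b L `|modz (scaled_floor b (a + L) x) (b ^ L)%N| k)%N.
Proof.
have b0 : (0 < b)%N by lia.
set F := scaled_floor b (a + L) x; set z := absz _.
have FE : F = divz F (b ^ L)%N * (b ^ L)%N%:Z + z%:Z.
  by rewrite {1}(divz_eq F (b ^ L)%N) /z gez0_abs // modz_ge0 //;
    have := expn_gt0 b L; lia.
rewrite /digit_count big_split_ord /=; congr (_ + _)%N.
rewrite (reindex_inj rev_ord_inj) /=; apply: eq_bigr => j _.
have -> : (a + (L - j.+1) = (a + L) - j.+1)%N by have := ltn_ord j; lia.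
rewrite digit_scaled_floor //; last by have := ltn_ord j; lia.
rewrite -/F FE; move: (divz F _) => Q.
have -> : (b ^ L)%N%:Z = (b ^ (L - j.+1))%N%:Z * b%:Z * b%:Z ^+ j.
  rewrite -PoszX -!PoszM -expnSr -expnD; congr (Posz (_ ^ _)).
  by have := ltn_ord j; lia.
have bj : b%:Z ^+ j != 0 by rewrite expf_neq0; lia.
rewrite mulrA divzMDl // mulrA modzMDl -PoszX divz_nat modz_nat eqz_nat //.
Qed.

(** Balance of a block depends only on a residue of the floor at its right end. A shift changes this
    residue by its own residue and a carry. *)
Lemma balancedE x k r v m : balanced b x k r v m =
  ~~ unbalanced b r (2 ^ m) k
       `|modz (scaled_floor b (v.+1 * 2 ^ m) x) (b ^ (2 ^ m))%N|%N.
Proof.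
have E : (v.+1 * 2 ^ m = v * 2 ^ m + 2 ^ m)%N by rewrite mulSn addnC.
rewrite /balanced /unbalanced negbK /discrepancy E digit_count_window.
congr (_ * `|_| <= _); rewrite !PoszD; ring.
Qed.

Lemma scaled_floor_block t a L (J : nat) : (J < b ^ L)%N ->
  (forall i, (a <= i < a + L)%N ->
     digit b t i = ((J %/ b ^ (a + L - i.+1)) %% b)%N) ->
  modz (scaled_floor b (a + L) t) (b ^ L)%N = J.
Proof.
move=> JL dt.
have E i : (i <= L)%N ->
    scaled_floor b (a + i) t = scaled_floor b a t * (b ^ i)%N%:Z + (J %/ b ^ (L
      - i))%N%:Z.
  elim: i => [|i IH] iL; first by rewrite addn0 subn0 divn_small // mulr1 addr0.
  have -> : scaled_floor b (a + i.+1) t =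
      b%:Z * scaled_floor b (a + i) t + digit b t (a + i) by rewrite addnS
        /digit; ring.
  rewrite IH ?(ltnW iL) // dt; last by lia.
  have -> : (a + L - (a + i).+1 = L - i.+1)%N by lia.
  have {1}-> : (L - i = (L - i.+1).+1)%N by lia.
  rewrite expnSr divnMA expnS PoszM; move: (J %/ _)%N => Q.
  have -> : Q%:Z = (Q %/ b)%N%:Z * b%:Z + (Q %% b)%N%:Z.
    by rewrite -PoszM -PoszD -divn_eq.
  ring.
rewrite E // subnn divn1 modzMDl modz_small //; lia.
Qed.

Lemma exists_real_with_digits (d : nat -> nat) : (forall i, (d i < b)%N) ->
  (forall n, exists2 k, (n <= k)%N & ((d k).+1 < b)%N) ->
  exists2 y : R, expansion R b d @ \oo --> y & forall i, digit b y i = d i.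
Proof.
move=> db inf; have /cvg_ex[y cy] := @is_cvg_expansion R b hb d db.
by exists y => //; have [] := expansion_digit hb db inf cy.
Qed.

(** In era [m], [t] carries the string [J m] on the first block and [s] alternates on the second.
    Their supports are disjoint, so [t + s] is formed without carries and shows the same strings
    [J m]. *)
Lemma exists_sparse_shift u (J : nat -> nat) : (4 <= u)%N ->
  (forall m, (J m < b ^ (2 ^ m))%N) -> exists t s, [/\
    forall m, modz (scaled_floor b (u.+1 * 2 ^ m) t) (b ^ (2 ^ m))%N = J m /\
      modz (scaled_floor b (u.+1 * 2 ^ m) (t + s)) (b ^ (2 ^ m))%N = J m,
    forall m i, ((u + 2) * 2 ^ m <= i < u * 2 ^ m.+1)%N ->
      digit b t i = 0 /\ digit b (t + s) i = 0 &
    forall m j, (u.+1 * 2 ^ m <= j < (u + 2) * 2 ^ m)%N ->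
      digit b s j.*2 = 1 /\ digit b s j.*2.+1 = 0].
Proof.
move=> u4 JN; pose era i := trunc_log 2 (i %/ u).
have eraE m i : (u * 2 ^ m <= i < u * 2 ^ m.+1)%N -> era i = m.
  move=> /andP[l h]; apply: trunc_log_eq => //.
  by rewrite leq_divRL ?ltn_divLR; [rewrite mulnC l mulnC h|lia..].
pose dt i := if (u * 2 ^ era i <= i < u.+1 * 2 ^ era i)%N
  then ((J (era i) %/ b ^ (u.+1 * 2 ^ era i - i.+1)) %% b)%N else 0%N.
pose ds i := if (u.+1 * 2 ^ era i <= i < (u + 2) * 2 ^ era i)%N
  then nat_of_bool (~~ odd i) else 0%N.
have dtE m i : (u * 2 ^ m <= i < u * 2 ^ m.+1)%N -> dt i =
    if (i < u.+1 * 2 ^ m)%N then ((J m %/ b ^ (u.+1 * 2 ^ m - i.+1)) %% b)%N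
      else 0%N.
  by move=> hi; rewrite /dt (eraE m i hi); case/andP: hi => -> _.
have dsE m i : (u * 2 ^ m <= i < u * 2 ^ m.+1)%N -> ds i =
    if (u.+1 * 2 ^ m <= i < (u + 2) * 2 ^ m)%N then nat_of_bool (~~ odd i) else
      0%N.
  by move=> hi; rewrite /ds (eraE m i hi).
have dt_b i : (dt i < b)%N by rewrite /dt; case: ifP => _; rewrite ?ltn_mod;
  lia.
have ds_b i : (ds i < b)%N by rewrite /ds; case: ifP => _; [case: odd|]; lia.
have disj i : dt i = 0%N \/ ds i = 0%N.
  rewrite /dt /ds; case: ifP => [/andP[_ h]|_]; last by left.
  by case: ifP => [/andP[h' _]|_]; [lia|right].
have dts_b i : (dt i + ds i < b)%N.
  have [->|->] := disj i; rewrite ?addn0 ?add0n //. 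
have gap m i : ((u + 2) * 2 ^ m <= i < u * 2 ^ m.+1)%N -> dt i = 0%N /\ ds i =
  0%N.
  move=> hi; have p0 : (0 < 2 ^ m)%N by rewrite expn_gt0.
  have hi' : (u * 2 ^ m <= i < u * 2 ^ m.+1)%N by nia.
  rewrite (dtE m) // (dsE m) //; case: ifP; first by nia.
  by move=> _; split=> //; case: ifP => //; lia.
(* The zeros in the gaps keep the expansions from ending in digits [b - 1], which could happen for
   [b = 2]. *)
have inf n : exists2 k, (n <= k)%N & dt k = 0%N /\ ds k = 0%N.
  exists ((u + 2) * 2 ^ n)%N.
    by apply: leq_trans (leq_pmull _ _); [exact/ltnW/ltn_expl|lia].
  apply: (gap n); rewrite leqnn /= expnS;
    have : (0 < 2 ^ n)%N by rewrite expn_gt0.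
  by nia.
have [t ct tE] : exists2 y : R, expansion R b dt @ \oo --> y & forall i, digit
  b y i = dt i.
  by apply: exists_real_with_digits => // n; have [k nk [h _]] := inf n;
    exists k; rewrite ?h.
have [s cs sE] : exists2 y : R, expansion R b ds @ \oo --> y & forall i, digit
  b y i = ds i.
  by apply: exists_real_with_digits => // n; have [k nk [_ h]] := inf n;
    exists k; rewrite ?h.
have tsE i : digit b (t + s) i = (dt i + ds i)%N.
  have cts : expansion R b (fun i => dt i + ds i)%N @ \oo --> t + s.
    rewrite (_ : expansion _ _ _ = fun n => expansion R b dt n + expansion R b
      ds n).
      exact: cvgD.
    apply/funext => n; rewrite /expansion /series /= -big_split /=.
    by apply: eq_bigr => l _; rewrite natrD mulrDl.
  have [|_ -> //] := expansion_digit hb dts_b _ cts.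
  by move=> n; have [k nk [h1 h2]] := inf n; exists k; rewrite ?h1 ?h2.
exists t, s; split.
- move=> m; have p0 : (0 < 2 ^ m)%N by rewrite expn_gt0.
  have E : (u.+1 * 2 ^ m = u * 2 ^ m + 2 ^ m)%N by rewrite mulSn addnC.
  have dE i : (u * 2 ^ m <= i < u * 2 ^ m + 2 ^ m)%N ->
      dt i = ((J m %/ b ^ (u * 2 ^ m + 2 ^ m - i.+1)) %% b)%N /\ ds i = 0%N.
    move=> hi; have hi' : (u * 2 ^ m <= i < u * 2 ^ m.+1)%N by rewrite expnS;
      nia.
    rewrite (dtE m) // (dsE m) // E; case: ifP; last by lia.
    by move=> _; split=> //; case: ifP => //; lia.
  rewrite E; split; apply: scaled_floor_block => // i /dE[h1 h2].
    by rewrite tE h1.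
  by rewrite tsE h1 h2 addn0.
- by move=> m i /gap[h1 h2]; rewrite tE tsE h1 h2.
- move=> m j hj; have p0 : (0 < 2 ^ m)%N by rewrite expn_gt0.
  (* Doubling [j] leads from the window of era [m] to the one of era [m.+1]. *)
  have h0 : (u.+1 * 2 ^ m.+1 <= j.*2 /\ j.*2.+1 < (u + 2) * 2 ^ m.+1)%N.
    by rewrite expnS; nia.
  have h1 : (u * 2 ^ m.+1 <= j.*2 /\ j.*2.+1 < u * 2 ^ m.+2)%N.
    by rewrite !expnS; nia.
  rewrite !sE !(dsE m.+1) /=; [|lia..].
  by case: ifP; [case: ifP; [rewrite odd_double|lia]|lia].
Qed.

(** If [x + y] is in [BE], for [y] equal to [t] or [t + s], its digit 0 has frequency 1: otherwise
    [sparse_perturbation] would bring the frequencies of [x] near convergent ones, against the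
    failure of [cauchy_at]. By [alternating_shift] this cannot happen for both. *)
Lemma shift_not_BE u q k x t s : (k < b)%N -> (32 * q.+1 <= u)%N ->
  ~ cauchy_at (digit_freq b x k) q ->
  (forall m i, ((u + 2) * 2 ^ m <= i < u * 2 ^ m.+1)%N ->
    digit b t i = 0 /\ digit b (t + s) i = 0) ->
  (forall m j, (u.+1 * 2 ^ m <= j < (u + 2) * 2 ^ m)%N ->
    digit b s j.*2 = 1 /\ digit b s j.*2.+1 = 0) ->
  ~ @BE R b (x + t) \/ ~ @BE R b (x + (t + s)).
Proof.
move=> kb qu nc gap alt.
have freq0 y : (forall m i, ((u + 2) * 2 ^ m <= i < u * 2 ^ m.+1)%N -> digit b
  y i = 0) ->
    @BE R b (x + y) -> digit_freq b (x + y) 0 @ \oo --> (1 : R).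
  move=> y0 /(BE_P hb) cf; have /cvg_ex[a ca] := cf 0%N (ltnW hb).
  have [<-//|/negP/negP a1] := eqVneq a 1.
  have [|K hK] := sparse_perturbation hb _ y0 ca a1; first by lia.
  exfalso; apply: nc.
  have u0 : (0 < u)%N by lia.
  apply: (@cauchy_at_close R b hb _ _ _ (K%:R / u%:R) u q (cf k kb)) => // n n0.
  have dle : `|(digit_count b x k n)%:R - (digit_count b (x + y) k n)%:R| <=
      (digit_diff b x (x + y) n)%:R :> R.
    have h1 := digit_count_diff b x (x + y) k n.
    have := digit_count_diff b (x + y) x k n; rewrite digit_diffC => h2.
    move: h1 h2; rewrite -!(ler_nat R) !natrD ler_norml => h1 h2.
    by apply/andP; split; lra.
  rewrite /digit_freq -mulrBl normrM normfV [`|n%:R|]ger0_norm //.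
  have nR : 0 < n%:R :> R by rewrite ltr0n.
  have uR : 0 < u%:R :> R by rewrite ltr0n.
  rewrite ler_pdivrMr // (le_trans dle) // -(@ler_pM2l _ u%:R) //.
  have -> : u%:R * ((K%:R / u%:R / n%:R + 8 / u%:R) * n%:R) = K%:R + 8 * n%:R
    :> R.
    by field; rewrite !gt_eqF.
  by rewrite -!natrM -natrD ler_nat.
have [B1|] := pselect (@BE R b (x + t)); last by left.
right=> B2.
have c1 := freq0 t (fun m i hi => (gap m i hi).1) B1.
have c2 := freq0 (t + s) (fun m i hi => (gap m i hi).2) B2.
pose W (z : R) m : R := (digit_count b z 0 ((u + 2) * 2 ^ m)%N)%:R / (2 ^
  m)%N%:R -
      (digit_count b z 0 (u.+1 * 2 ^ m)%N)%:R / (2 ^ m)%N%:R.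
have w (z : R) : digit_freq b z 0 @ \oo --> (1 : R) -> W z @ \oo --> (1 : R).
  move=> cz.
  rewrite [X in _ --> X](_ : 1 = 1 * (u + 2)%N%:R - 1 * u.+1%:R); last first.
    rewrite !mul1r -natrB; last by lia.
    by have -> : (u + 2 - u.+1 = 1)%N by lia.
  by apply: cvgB; apply: cvg_window_count => //; lia.
have c12 : (fun m => W (x + t) m + W (x + (t + s)) m) @ \oo --> (1 + 1 : R).
  exact: cvgD (w _ c1) (w _ c2).
(* The two window densities of the digit 0 would tend to the sum 2, while [alternating_shift] bounds
   this sum by 3/2. *)
have half0 : (0 : R) < 2^-1 by rewrite invr_gt0.
have /cvgrPdist_lt/(_ _ half0)[M _ hM] := c12.
have := hM M.+1 (leqnSn M); rewrite /W /=.
have p0 : (0 : R) < (2 ^ M.+1)%N%:R by rewrite ltr0n expn_gt0.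
have le : (u.+1 * 2 ^ M <= (u + 2) * 2 ^ M)%N by rewrite leq_mul2r; lia.
have := @alternating_shift R b hb (x + t) s _ _ le (alt M).
rewrite -mulnBl -!mul2n !(mulnCA 2) -!expnS.
have -> : (u + 2 - u.+1 = 1)%N by lia.
rewrite mul1n -addrA.
move: (digit_count b (x + t) 0 _) (digit_count b (x + (t + s)) 0 _) => A B.
move: (digit_count b (x + t) 0 _) (digit_count b (x + (t + s)) 0 _) => C D.
have -> : (2 ^ M.+1)%N%:R = 2 * (2 ^ M)%N%:R :> R by rewrite expnS natrM.
have : 0 < (2 ^ M)%N%:R :> R by rewrite ltr0n expn_gt0.
move: (2 ^ M)%N => n pn h.
have {}h : A%:R + B%:R <= C%:R + D%:R + 3 * n%:R :> R.
  by rewrite -natrM -!natrD ler_nat.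
move: (n%:R : R) pn h => p {}p0 h.
have -> : A%:R / (2 * p) - C%:R / (2 * p) + (B%:R / (2 * p) - D%:R / (2 * p)) =
    (A%:R + B%:R - (C%:R + D%:R)) / (2 * p) by ring.
rewrite ltr_norml => /andP[_]; rewrite ltrBlDr -ltrBlDl ltr_pdivlMr ?mulr_gt0
  //.
lra.
Qed.
End SparseShifts.

(** * Negligibility of the complement of [BE] *)

Lemma card_residue_shift (N : nat) (P : pred nat) (f : int) : (0 < N)%N ->
  (#|[pred j : 'I_N | P `|modz (f - j%:Z) N|%N]| <= #|[pred z : 'I_N | P z]|)%N.
Proof.
move=> N0; have lt (j : 'I_N) : (`|modz (f - j%:Z) N| < N)%N.
  have := ltz_pmod (f - j%:Z) (d := N) ltac:(lia).
  have := modz_ge0 (f - j%:Z) (d := N) ltac:(lia).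
  lia.
pose g j := Ordinal (lt j).
have g_inj : injective g.
  move=> i j /(congr1 val) /= E; apply/val_inj => /=.
  have Ez : modz (f - i%:Z) N = modz (f - j%:Z) N.
    have := modz_ge0 (f - i%:Z) (d := N) ltac:(lia).
    have := modz_ge0 (f - j%:Z) (d := N) ltac:(lia).
    lia.
  have : (modz (i%:Z) N = modz (j%:Z) N).
    have -> : i%:Z = f - (f - i%:Z) by ring.
    have -> : j%:Z = f - (f - j%:Z) by ring.
    by rewrite -(modzDmr f) -modzNm Ez modzNm modzDmr.
  by rewrite !modz_small; [case|have := ltn_ord j; lia|have := ltn_ord i; lia].
rewrite -(fintype.card_image g_inj); apply: subset_leq_card.
by apply/fintype.subsetP => z /fintype.imageP[j hj ->]; exact: hj.
Qed.

Section Immeasurability.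
Variables (R : realType) (b : nat).
Hypothesis hb : (1 < b)%N.
Implicit Types (x y t s : R) (i j k m n r u v q : nat).

Lemma digit_count_avoid x k n1 n2 :
  (forall i, (n1 <= i < n2)%N -> digit b x i != k) -> (n1 <= n2)%N ->
  digit_count b x k n2 = digit_count b x k n1.
Proof.
move=> dk /subnK; move: (n2 - n1)%N => d E; rewrite -E in dk *.
elim: d {E} dk => [|d IH] dk //.
rewrite addSn digit_countS (negbTE (dk _ _)) ?addn0 ?IH //; last by lia.
by move=> i hi; apply: dk; lia.
Qed.

(** The digits are 0 or 1 according to the parity of [m] on [[2 ^ m, 2 ^ m.+1)], so the density of
    the digit 1 on these windows alternates between 0 and 1. *)
Lemma setC_BE_nonempty : ~` @BE R b !=set0.
Proof.
pose d i := nat_of_bool (odd (trunc_log 2 i)).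
have dE m i : (1 * 2 ^ m <= i < 2 * 2 ^ m)%N -> d i = odd m.
  by move=> hi; rewrite /d (@trunc_log_eq _ m) //; rewrite expnS; lia.
have db i : (d i < b)%N by rewrite /d; case: odd => /=; lia.
have [x _ xE] : exists2 x : R, expansion R b d @ \oo --> x & forall i, digit b
  x i = d i.
  apply: exists_real_with_digits => // n; exists (2 ^ n.*2)%N.
    apply: leq_trans (ltnW (ltn_expl _ (ltnSn 1))); rewrite -addnn leq_addr //.
  by rewrite (dE n.*2) ?odd_double //; have := expn_gt0 2 n.*2; lia.
exists x => /(BE_P hb)/(_ 1%N hb)/cvg_ex[a ca].
have [c1 c2] : (fun m => (digit_count b x 1 (1 * 2 ^ m)%N)%:R / (2 ^ m)%N%:R) @
  \oo --> a /\
   (fun m => (digit_count b x 1 (2 * 2 ^ m)%N)%:R / (2 ^ m)%N%:R) @ \oo --> a *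
     2%N%:R.
  split; last exact: cvg_window_count.
  by rewrite -[X in _ --> X]mulr1; exact: (@cvg_window_count _ _ _ _ _ 1).
have half0 : (0 : R) < 2^-1 by rewrite invr_gt0.
have c3 : (fun m => (digit_count b x 1 (2 * 2 ^ m)%N)%:R / (2 ^ m)%N%:R -
    (digit_count b x 1 (1 * 2 ^ m)%N)%:R / (2 ^ m)%N%:R) @ \oo --> a * 2%N%:R -
      a.
  exact: cvgB c2 c1.
have /cvgrPdist_lt/(_ _ half0)[M _ hM] := c3.
have le m : (1 * 2 ^ m <= 2 * 2 ^ m)%N by rewrite leq_mul2r orbT.
have lt_even : `|a * 2%N%:R - a - 0| < 2^-1.
  have <- : (digit_count b x 1 (2 * 2 ^ M.*2)%N)%:R / (2 ^ M.*2)%N%:R -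
      (digit_count b x 1 (1 * 2 ^ M.*2)%N)%:R / (2 ^ M.*2)%N%:R = 0 :> R.
    rewrite (digit_count_avoid _ (le _)) ?subrr // => i hi.
    by rewrite xE (dE M.*2) //= odd_double.
  by apply: hM; rewrite /= -addnn leq_addr.
have lt_odd : `|a * 2%N%:R - a - 1| < 2^-1.
  have E1 : (digit_count b x 1 (2 * 2 ^ M.*2.+1)%N)%:R / (2 ^ M.*2.+1)%N%:R -
      (digit_count b x 1 (1 * 2 ^ M.*2.+1)%N)%:R / (2 ^ M.*2.+1)%N%:R = 1 :> R.
    rewrite (digit_count_interval hb _ (le _)) => [|i hi]; last first.
      by rewrite xE (dE M.*2.+1) //= odd_double.
    by rewrite -mulnBl mul1n natrD mulrDl addrAC subrr add0r divff //.
  rewrite -[X in `|_ - X|]E1; apply: hM.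
  by rewrite /= -addnn -addnS leq_addr.
by move: lt_even lt_odd; rewrite !ltr_norml => /andP[? ?] /andP[? ?]; lra.
Qed.

(** The strings [J] are chosen first, and [t] and [s] are built from them. Since [t] and [t + s]
    have the same residues [J m], one null set serves both shifts. *)
Lemma unbalanced_limsup_negligible (S : set (set R)) k q u
    (mu : {measure set (g_sigma_algebraType S) -> \bar R}) :
  sigma_algebra setT S -> measurable `<=` S -> translation_invariant mu ->
  sigma_finite (~` @BE R b : set (g_sigma_algebraType S)) mu ->
  (k < b)%N -> (32 * q.+1 <= u)%N ->
  mu.-negligible (~` @BE R b `&` [set x | ~ cauchy_at (digit_freq b x k) q] `&`
    lim_sup_set (fun m => [set x | ~~ balanced b x k (32 * q.+1) u m])).
Proof.
move=> sS BS inv sB kb qu; set r := (32 * q.+1)%N; set V := lim_sup_set _.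
have mS (A : set R) : measurable A -> measurable (A : set (g_sigma_algebraType
  S)).
  by rewrite measurable_g_measurableTypeE // => /BS.
pose N m := (b ^ (2 ^ m))%N.
have N0 m : (0 < N m)%N by rewrite expn_gt0; lia.
pose bad m (f : int) := unbalanced b r (2 ^ m) k `|modz f (N m)|%N.
pose e m := (u.+1 * 2 ^ m)%N.
(* If [tau] has residue [j] on the block and [x - tau] is unbalanced there, then [x] is in [E m j];
   the second alternative allows for a carry entering the block from its right. *)
pose E m (j : 'I_(N m)) : set R := [set x | bad m (scaled_floor b (e m) x -
  j%:Z) ||
  bad m (scaled_floor b (e m) x - 1 - j%:Z)].
have mE m (j : 'I_(N m)) : measurable (E m j : set (g_sigma_algebraType S)).
  by apply: mS; apply: (measurable_scaled_floor (b := b) (n := e m)) => x y xy;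
    rewrite /E /= xy.
pose K m := (2 * #|[pred z : 'I_(N m) | unbalanced b r (2 ^ m) k z]|)%N.
(* For fixed [x], [j] -> [f - j] is injective modulo [N m], so each alternative holds for at most as
   many [j] as there are unbalanced strings. *)
have EK m x : (#|[pred j | x \in E m j]| <= K m)%N.
  have h1 := card_residue_shift (unbalanced b r (2 ^ m) k) (scaled_floor b (e
    m) x) (N0 m).
  have h2 := card_residue_shift (unbalanced b r (2 ^ m) k) (scaled_floor b (e
    m) x - 1) (N0 m).
  rewrite /K mul2n -addnn; apply: leq_trans (leq_add h1 h2).
  rewrite -cardUI; apply: leq_trans (leq_addr _ _); apply: subset_leq_card.
  by apply/fintype.subsetP => j; rewrite !inE.
(* In the factor 4, one 2 comes from the two alternatives and one from writing [2 ^ m.+1] for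
   [2 ^ m]. *)
have KN m : (K m)%:R / (N m)%:R <= (4 * r ^ 2 * b)%N%:R / (2 ^ m.+1)%N%:R :> R.
  rewrite ler_pdivrMr ?ltr0n ?N0 // mulrAC ler_pdivlMr ?ltr0n ?expn_gt0 //.
  rewrite -!natrM ler_nat /K expnS.
  have := card_unbalanced hb r (expn_gt0 2 m) kb.
  rewrite -/(N m); lia.
have [J mu0] := exists_null_limsup sB N0 (ler0n _ _) mE EK KN.
have [|t [s [tN gap alt]]] := exists_sparse_shift R hb (u := u) (J := J) _ (fun
  m => ltn_ord (J m)).
  by lia.
have mB : measurable (~` @BE R b) by apply: measurableC; exact: measurable_BE.
have mV : measurable V.
  apply: bigcapT_measurable => n; apply: bigcup_measurable => m _.
  apply: (measurable_scaled_floor (b := b) (n := e m)) => x y xy /=.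
  by rewrite !balancedE // -/(e m) xy.
(* The translate by [tau] of the set in question lies in the null set of [mu0], and invariance of
   [mu] carries measure 0 back. *)
have null tau : (forall m, modz (scaled_floor b (e m) tau) (N m) = J m) ->
    mu.-negligible (V `&` [set x | ~ @BE R b (x + tau)]).
  move=> tauJ; set X := V `&` _.
  have mX : measurable X.
    apply: measurableI => //; rewrite -[X in measurable X]setTI.
    have : measurable_fun setT (fun x : R => x + tau).
      by apply: measurable_funD => //; exact: measurable_cst.
    by move=> /(_ measurableT _ mB).
  have [SX eqX] := inv X tau (BS _ mX).
  apply/negligibleP; first exact: mS.
  have mtr : measurable (translate X tau : set (g_sigma_algebraType S)).
    by rewrite measurable_g_measurableTypeE.
  apply: (etrans (esym eqX)); apply: (subset_measure0 mtr _ _ mu0).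
    apply: measurableI; first exact: mS.
    by apply: bigcapT_measurable => n; apply: bigcup_measurable => m _;
      exact: mE.
  move=> _ [x [Vx Bx] <-]; split=> // n _.
  have [m nm] := Vx n I; rewrite /= balancedE // negbK -/(e m) -/(bad m _) =>
    badm.
  exists m => //; rewrite /E /=.
  have Q : scaled_floor b (e m) tau =
      divz (scaled_floor b (e m) tau) (N m) * (N m)%:Z + (J m)%:Z.
    by rewrite -tauJ -divz_eq.
  have Fx : scaled_floor b (e m) (x + tau) - carry b x tau (e m) - (J m)%:Z =
      divz (scaled_floor b (e m) tau) (N m) * (N m)%:Z + scaled_floor b (e m) x.
    by rewrite /carry {1}Q; ring.
  have {}badm : bad m (scaled_floor b (e m) (x + tau) - carry b x tau (e m) -
    (J m)%:Z).
    by rewrite /bad Fx modzMDl.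
  have [c0|c1] : carry b x tau (e m) = 0 \/ carry b x tau (e m) = 1.
    by have := carry_itv hb x tau (e m); lia.
  - by rewrite c0 subr0 in badm; rewrite badm.
  - by rewrite c1 in badm; rewrite badm orbT.
apply: (negligibleS _ (negligibleU (null t (fun m => (tN m).1)) (null (t + s)
  (fun m => (tN m).2)))).
move=> x [[Bx nc] Vx].
by have [?|?] := shift_not_BE hb kb qu nc gap alt; [left|right].
Qed.

End Immeasurability.

Theorem theorem2p5 (R : realType) (b : nat) (hb : (2 <= b)%N) :
  immeasurable (~` @BE R b).
Proof.
split; [exact: setC_BE_nonempty|by apply: measurableC; exact: measurable_BE|].
move=> S sS BS mu inv.
have [sB|] := pselect (sigma_finite (~` @BE R b : set (g_sigma_algebraType S))
  mu);
  last by right.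
have mB : measurable (~` @BE R b : set (g_sigma_algebraType S)).
  by rewrite measurable_g_measurableTypeE //; apply/BS/measurableC;
    exact: measurable_BE.
suff neg : mu.-negligible (~` @BE R b) by left; apply/(negligibleP mu mB).
(* Inadmissible parameters give the empty set, so that the unions run over all natural numbers. *)
pose V k q u := if (k < b)%N && (32 * q.+1 <= u)%N then
   ~` @BE R b `&` [set x | ~ cauchy_at (digit_freq b x k) q] `&`
    lim_sup_set (fun m => [set x | ~~ balanced b x k (32 * q.+1) u m]) else
      set0.
(* For [x] outside [BE], some digit [k] fails the Cauchy criterion at some [q]; by
   [balanced_cauchy_at] with [r = 32 * q.+1], infinitely many blocks with one and the same index [u]
   are then unbalanced. *)
have cover : ~` @BE R b `<=` \bigcup_k \bigcup_q \bigcup_u V k q u.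
  move=> x Bx; apply: contrapT => nV; apply: (Bx); apply/(BE_P hb) => k kb.
  apply/cvgn_cauchyP => q; apply: contrapT => nc; apply: nV.
  exists k => //; exists q => //; apply: contrapT => nV; apply: (nc).
  apply: (balanced_cauchy_at hb (leqnn (32 * q.+1))) => u /andP[qu _].
  apply: contrapT => nb; apply: nV; exists u => //; rewrite /V kb qu /=.
  split; first by split.
  move=> n _; apply: contrapT => bal; apply: nb; exists n => m nm.
  by apply: contrapT => /negP unb; apply: bal; exists m.
have negV : mu.-negligible (\bigcup_k \bigcup_q \bigcup_u V k q u).
  apply: negligible_bigcup => k; apply: negligible_bigcup => q.
  apply: negligible_bigcup => u; rewrite /V; case: ifP => [/andP[kb qu]|_].
    exact: unbalanced_limsup_negligible.
  exact: negligible_set0.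
exact: (@negligibleS _ (g_sigma_algebraType S) _ mu _ _ cover negV).
Qed.
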